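(* Let $f:\Omega\to\mathbb{R}$ be a continuous potential of product type, $f(x)=\sum_{j=1}^{\infty} f_j(x_j)$, where $f_j:[0,1]\to\mathbb{R}$ are fixed functions and the series converges absolutely for every $x\in\Omega=[0,1]^{\mathbb{N}}$. Suppose that the iterated series $\sum_{j=1}^{\infty}\sum_{i>j} f_i(x_j)$ converges (to a finite real number) for every $x=(x_1,x_2,\dots)\in\Omega$. Write $g_i=e^{f_i}$ and $F(a)=\sum_{i=1}^{\infty} f_i(a)=f(a,a,a,\dots)$ for $a\in[0,1]$. Let $\mu_f=\bigotimes_{n=1}^{\infty}\mu_n$ and $\tilde\mu_f=\bigotimes_{n=1}^{\infty}\tilde\mu_0$ be the product measures on $\Omega$ whose factors are the measures on $[0,1]$ given by $$d\mu_n(a)=\frac{\prod_{i=1}^{n} g_i(a)\,da}{\int_0^1\prod_{j=1}^{\infty} g_j(b)\,db},\qquad d\tilde\mu_0(a)=\frac{\prod_{i=1}^{\infty} g_i(a)\,da}{\int_0^1\prod_{j=1}^{\infty} g_j(b)\,db}=\frac{e^{F(a)}\,da}{\int_0^1 e^{F(b)}\,db}.$$ Then $$\mathcal{L}_f^*(\mu_f)=\lambda_f\,\mu_f,\qquad \mathcal{L}_{\tilde f}^*(\tilde\mu_f)=\tilde\mu_f,\qquad \mu_f=\frac{1}{h_f}\,\tilde\mu_f .$$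
   Context: $\Omega=[0,1]^{\mathbb{N}}$ is equipped with the metric $d(x,y)=\sum_{n\ge1}|x_n-y_n|/2^n$. $\sigma:\Omega\to\Omega$ is the shift $\sigma(x_1,x_2,x_3,\dots)=(x_2,x_3,\dots)$. For a continuous function $f:\Omega\to\mathbb{R}$, the Ruelle operator on continuous functions $\varphi:\Omega\to\mathbb{R}$ is $$\mathcal{L}_f(\varphi)(x)=\int_0^1 e^{f(a,x_1,x_2,\dots)}\,\varphi(a,x_1,x_2,\dots)\,da,$$ with $da$ Lebesgue measure, and its dual $\mathcal{L}_f^*$ acts on Borel measures by $\int\varphi\,d\mathcal{L}_f^*(\mu)=\int\mathcal{L}_f(\varphi)\,d\mu$ for all continuous $\varphi$. With $g_i=e^{f_i}$, one sets $$h_j(b)=\prod_{i>j}g_i(b),\qquad h_f(x)=\prod_{j=1}^{\infty}h_j(x_j),\qquad \lambda_f=\int_0^1\prod_{j=1}^{\infty}g_j(b)\,db,$$ and the normalized potential associated to $f$ is $\tilde f=f+\log h_f-\log h_f\circ\sigma-\log\lambda_f$. The notation $\mu_f=\frac1{h_f}\tilde\mu_f$ means that $\int\varphi\,d\mu_f=\int\varphi\,\frac1{h_f}\,d\tilde\mu_f$ for all continuous $\varphi$. Since the finite positive measures $\mu_n$ need not be probabilities, the infinite product is understood as $\bigotimes_{n}\mu_n=\Big(\prod_{n=1}^{\infty}\mu_n([0,1])\Big)\bigotimes_{n}\frac{\mu_n}{\mu_n([0,1])}$, the infinite product of masses being the limit of its partial products. Iterated sums $\sum_j\sum_{i>j}$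 mean: first sum over $i>j$, then over $j$. *)

(* Defs.v *)
From HB Require Import structures.
From mathcomp Require Import all_boot all_order all_algebra.
From mathcomp Require Import all_classical all_reals all_analysis.
From mathcomp Require Import ring lra.
Set Implicit Arguments.
Unset Strict Implicit.
Unset Printing Implicit Defensive.
Import Order.TTheory GRing.Theory Num.Theory.
Import numFieldNormedType.Exports.
Local Open Scope classical_set_scope.
Local Open Scope ring_scope.

Definition unitI (R : realType) : Type := {x : R | 0 <= x <= 1}.
Definition uval (R : realType) (a : unitI R) : R := sval a.
Arguments uval {R} a.

Section unit_interval.
Variable R : realType.
Implicit Type A : set (unitI R).

Let unitI0_subproof : (0 : R) <= (0 : R) <= (1 : R).
Proof. by rewrite lexx ler01. Qed.

HB.instance Definition _ := Choice.copy (unitI R) {x : R | 0 <= x <= 1}.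
HB.instance Definition _ := isPointed.Build (unitI R)
  (exist (fun x : R => 0 <= x <= 1) 0 unitI0_subproof).

Lemma uval_inj : injective (@uval R).
Proof. exact: val_inj. Qed.

(* Borel sets of [0, 1]: the traces of the Borel sets of the line. *)
HB.instance Definition _ := Measurable.copy (unitI R)
  (g_sigma_algebra_preimageType (@uval R)).

Lemma measurable_uval_image A : measurable A -> measurable (uval @` A).
Proof.
move=> [B mB <-]; rewrite setTI.
rewrite (_ : _ @` _ = `[0, 1] `&` B).
  exact: measurableI.
apply/seteqP; split=> [_ [[x x01] /= Bx <-]|x /= [x01 Bx]].
  by rewrite /= in_itv.
rewrite /= in_itv /= in x01.
by exists (exist _ x x01).
Qed.

Definition lebesgueI A : \bar R := lebesgue_measure (uval @` A).

Let lebesgueI0 : lebesgueI set0 = 0%E.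
Proof. by rewrite /lebesgueI image_set0 measure0. Qed.

Let lebesgueI_ge0 A : (0 <= lebesgueI A)%E.
Proof. exact: measure_ge0. Qed.

Let lebesgueI_sigma_additive : semi_sigma_additive lebesgueI.
Proof.
move=> F mF tF mUF; rewrite /lebesgueI image_bigcup.
apply: measure_semi_sigma_additive.
- by move=> i; exact: measurable_uval_image.
- apply/trivIsetP => i j _ _ ij; apply/seteqP; split=> // _ [[a Fa <-] [b Fb]].
  move=> /uval_inj ba; rewrite ba in Fb.
  move/trivIsetP : tF => /(_ i j Logic.I Logic.I ij) Fij.
  by have : (F i `&` F j) a by []; rewrite Fij.
- by rewrite -image_bigcup; exact: measurable_uval_image.
Qed.

HB.instance Definition _ := isMeasure.Build _ _ _ lebesgueI
  lebesgueI0 lebesgueI_ge0 lebesgueI_sigma_additive.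

End unit_interval.

(* Coordinates are numbered from 0: [x n] is the coordinate x_{n+1}, so the
   weight of [x n] in the distance is 2^-(n+1). *)
Definition Omega (R : realType) : Type := nat -> unitI R.

Section Omega_space.
Variable R : realType.
Implicit Types x y z : Omega R.

HB.instance Definition _ := Choice.copy (Omega R) (nat -> unitI R).
HB.instance Definition _ := isPointed.Build (Omega R) (fun=> point).

Let term x y n : R := `|uval (x n) - uval (y n)| / 2 ^+ n.+1.

Definition Omega_dist x y : R :=
  limn (series (fun n => `|uval (x n) - uval (y n)| / 2 ^+ n.+1)).

Let term_ge0 x y n : 0 <= term x y n.
Proof. by rewrite divr_ge0// exprn_ge0. Qed.

Lemma is_cvg_Omega_dist x y : cvgn (series (term x y)).
Proof.
apply: (@series_le_cvg _ _ (geometric 2^-1 2^-1)) => [n|n|n|].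
- exact: term_ge0.
- by rewrite /geometric/= mulr_ge0// exprn_ge0.
- rewrite /geometric/= /term -exprS exprVn ler_piMl ?invr_ge0 ?exprn_ge0//.
  case: (x n) (y n) => a a01 [b b01]; rewrite /uval/= ler_norml.
  by move: a01 b01; lra.
- apply: is_cvg_geometric_series.
  by rewrite ger0_norm ?invr_ge0// invf_lt1 ?ltr1n.
Qed.

Let distxx x : Omega_dist x x = 0.
Proof.
rewrite /Omega_dist (_ : series _ = fun=> 0) ?lim_cst//.
by apply/funext => n; rewrite /series/= big1// => i _; rewrite subrr normr0 mul0r.
Qed.

Let dist_positivity x y : Omega_dist x y = 0 -> x = y.
Proof.
move=> d0; apply/funext => n; apply: uval_inj; apply/eqP.
have : term x y n <= 0.
  have nd : nondecreasing_seq (series (term x y)).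
    by apply: nondecreasing_series => i _ _; exact: term_ge0.
  have := nondecreasing_cvgn_le nd (@is_cvg_Omega_dist x y) n.+1.
  rewrite -/(Omega_dist x y) d0; apply: le_trans.
  by rewrite /series/= big_nat_recr//= lerDr sumr_ge0.
by rewrite pmulr_lle0 ?invr_gt0 ?exprn_gt0// normr_le0 subr_eq0.
Qed.

Let dist_sym x y : Omega_dist x y = Omega_dist y x.
Proof.
rewrite /Omega_dist; congr (limn (series _)).
by apply/funext => n; rewrite distrC.
Qed.

Let dist_triangle y x z : Omega_dist x z <= Omega_dist x y + Omega_dist y z.
Proof.
have cv u v := @is_cvg_Omega_dist u v.
rewrite /Omega_dist -limD; [|exact: cv..].
apply: ler_lim; [exact: cv|by apply: is_cvgD; exact: cv|].
apply: nearW => n; rewrite fctE /series/= -big_split/=.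
apply: ler_sum => i _; rewrite -mulrDl ler_pM2r ?invr_gt0 ?exprn_gt0//.
exact: ler_distD.
Qed.

HB.instance Definition _ := isMetric.Build R (Omega R)
  distxx dist_positivity dist_sym dist_triangle.

(* Borel sigma-algebra of the metric above. *)
HB.instance Definition _ := Measurable.copy (Omega R)
  (g_sigma_algebraType (@open (Omega R))).

Definition oshift x : Omega R := fun n => x n.+1.

Definition ocons (a : unitI R) x : Omega R :=
  fun n => if n is m.+1 then x m else a.

End Omega_space.

(* The limit of the partial products; [limn] is a junk value if they diverge. *)
Definition inf_prod (R : realType) (u : nat -> R) : R :=
  limn (fun n => \prod_(i < n) u i).

Lemma inf_prod_ge0 (R : realType) (u : nat -> R) :
  (forall i, 0 <= u i) -> 0 <= inf_prod u.
Proof.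
move=> u0; rewrite /inf_prod.
have [cu|/dvgP ->] := pselect (cvgn (fun n => \prod_(i < n) u i)); last by [].
by apply: limr_ge => //; apply: nearW => n; exact: prodr_ge0.
Qed.

Section transfer_operator.
Variable R : realType.
Implicit Types (f phi : Omega R -> R) (mu nu : {measure set (Omega R) -> \bar R}).

Definition ruelle f phi (x : Omega R) : R :=
  \int[@lebesgueI R]_a (expR (f (ocons a x)) * phi (ocons a x)).

(* [nu] is the image of [mu] under the dual of the operator [ruelle f]. *)
Definition ruelle_dual f mu nu : Prop :=
  forall phi, continuous phi ->
    (\int[nu]_x (phi x)%:E = \int[mu]_x (ruelle f phi x)%:E)%E.

(* [nu] is the measure with density [w] with respect to [mu]. *)
Definition reweighted (w : Omega R -> R) mu nu : Prop :=
  forall phi, continuous phi ->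
    (\int[nu]_x (phi x)%:E = \int[mu]_x (phi x * w x)%:E)%E.

(* The probability [P] is the product of the normalisations of the finite
   measures [nu n], characterised by its values on measurable cylinders. *)
Definition is_product_probability (m : nat -> set (unitI R) -> \bar R)
    (P : probability (Omega R) R) : Prop :=
  forall (n : nat) (A : nat -> set (unitI R)), (forall i, measurable (A i)) ->
    P [set x | forall i, (i < n)%N -> A i (x i)] =
    (\prod_(i < n) (fine (m i (A i)) / fine (m i [set: unitI R])))%:E.

(* Product of finite measures that need not be probabilities: the product of
   their normalisations, times the limit of the products of their masses. *)
Definition is_product_measure (m : nat -> set (unitI R) -> \bar R) mu : Prop :=
  exists (M : R) (P : probability (Omega R) R),
    [/\ (\prod_(i < n) fine (m i [set: unitI R])) @[n --> \oo] --> M,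
        is_product_probability m P &
        forall A, measurable A -> mu A = (M%:E * P A)%E].

End transfer_operator.

(* The functions f_1, f_2, ... are also numbered from 0: [fs j] is f_{j+1}. *)
Section product_potential.
Variables (R : realType) (fs : nat -> unitI R -> R).
Implicit Types (a b : unitI R) (x : Omega R).

Definition gs (i : nat) a : R := expR (fs i a).

(* The potential on constant sequences. *)
Definition Fdiag a : R := limn (series (fun i => fs i a)).

Definition hs (j : nat) b : R := inf_prod (fun k => gs (j.+1 + k) b).

Definition hf x : R := inf_prod (fun j => hs j (x j)).

Definition lambdaf : R := \int[@lebesgueI R]_b inf_prod (fun j => gs j b).

Lemma lambdaf_ge0 : 0 <= lambdaf.
Proof.
by apply: Rintegral_ge0 => b _; apply: inf_prod_ge0 => j; exact: expR_ge0.
Qed.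

Definition normalized_potential (f : Omega R -> R) x : R :=
  f x + ln (hf x) - ln (hf (oshift x)) - ln lambdaf.

(* [mu_factor n] is mu_{n+1}, whose density has the n + 1 factors g_1, ...,
   g_{n+1}. *)
Definition mu_factor (n : nat) (A : set (unitI R)) : \bar R :=
  (\int[@lebesgueI R]_(a in A) ((\prod_(i < n.+1) gs i a) /
    \int[@lebesgueI R]_b inf_prod (fun j => gs j b))%R%:E)%E.

Definition mutilde_factor (A : set (unitI R)) : \bar R :=
  (\int[@lebesgueI R]_(a in A) (inf_prod (fun i => gs i a) /
    \int[@lebesgueI R]_b inf_prod (fun j => gs j b))%R%:E)%E.

End product_potential.

(* Main.v *)
Require Import Defs.
From HB Require Import structures.
From mathcomp Require Import all_boot all_order all_algebra.
From mathcomp Require Import all_classical all_reals all_analysis.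
From mathcomp Require Import measurable_realfun ring lra.
Set Implicit Arguments.
Unset Strict Implicit.
Unset Printing Implicit Defensive.
Import Order.TTheory GRing.Theory Num.Theory.
Import numFieldNormedType.Exports.
Local Open Scope classical_set_scope.
Local Open Scope ring_scope.

(** The functions [f_i] are bounded, by compactness of the sequence space, and
    measurable, since [f_i(a)] is, up to a constant, the value of [f] at a
    sequence all of whose coordinates but the [i]-th are fixed. Choosing the
    worst point for each index shows that the series of the sup norms of the
    [f_i] converges and that, for the tails [r_j(a)], sums of the [f_i(a)] over
    [i > j], the partial sums of [r_j(x_j)] are bounded uniformly in [x]. Hence
    the function [H(x)], sum of the [r_j(x_j)], is bounded and measurable, and
    [h_f = exp H].

    As [r_j] is the sum of [f_(j+1)] and [r_(j+1)], the potential is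
    cohomologous to a function of the first coordinate only:
    [f(a,x) + H(a,x) - H(x) = F(a)] (lemma [potential_cohomology]). Therefore
    the normalized operator maps [phi] to the average of [phi(a,x)] with respect
    to the probability [m] of density [e^F / lambda]; its dual fixes the product
    of copies of [m], because adding an independent first coordinate of law [m]
    does not change the law of an independent sequence of law [m]
    ([bounded_integral_ocons]).

    The mass given by [mu_j] to [A] is the integral over [A] of [e^(-r_j)]
    with respect to [m]. By independence and dominated convergence, the measure
    of density [1 / h_f] with respect to the product of copies of [m] then gives
    to each cylinder the limit of the products of these masses
    ([cvg_cylinder]). This shows that the infinite product of the masses
    converges to a positive limit, that the product of the [mu_j] exists, and
    that it is the measure of density [1 / h_f]. The eigenvalue equation follows
    from the invariance, applied to the bounded function [lambda phi / h_f].

    The product of copies of [m] is obtained by extending a measure from the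
    algebra of the measurable sets of finite depth. Continuity at the empty set
    ([cylm_cvg0]) is proved by choosing the coordinates of a common point one
    after the other. The Borel sets of the metric are generated by the cylinders
    ([measurable_OmegaE]), which gives uniqueness. *)

(** * The metric space of sequences *)
Section Omega_topology.
Variable R : realType.
Implicit Types (x y : Omega R) (a b : unitI R).

Lemma uval_ge0 a : 0 <= uval a.
Proof. by case: a => r /= /andP[]. Qed.

Lemma uval_le1 a : uval a <= 1.
Proof. by case: a => r /= /andP[]. Qed.

Lemma uval_dist_le1 a b : `|uval a - uval b| <= 1.
Proof.
rewrite ler_norml; have := (uval_ge0 a, uval_le1 a, uval_ge0 b, uval_le1 b).
by move=> [[[]]]; lra.
Qed.

Lemma ball_OmegaE x (e : R) : ball x e = [set y | Omega_dist x y < e].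
Proof. exact: (@ballEmdist R (Omega R)). Qed.

(** Points whose first [n] coordinates are [e]-close are at distance at most
    [e + 2^-n]. *)
Lemma Omega_dist_le x y (e : R) n : 0 <= e ->
  (forall i, (i < n)%N -> `|uval (x i) - uval (y i)| <= e) ->
  Omega_dist x y <= e + 2^-1 ^+ n.
Proof.
move=> e0 xye; apply: limr_le; first exact: is_cvg_Omega_dist.
apply: nearW => N.
suff /le_trans : series (fun i => `|uval (x i) - uval (y i)| / 2 ^+ i.+1) N <=
    e * (1 - 2^-1 ^+ N) + (2^-1 ^+ n - 2^-1 ^+ maxn n N).
  apply; have h1 : 0 <= (2^-1 : R) ^+ N by exact: exprn_ge0.
  have h2 : 0 <= (2^-1 : R) ^+ maxn n N by exact: exprn_ge0.
  by nra.
elim: N => [|N IH].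
  by rewrite /series/= big_geq// expr0 subrr mulr0 maxn0 subrr addr0.
rewrite [leLHS]/series/= big_nat_recr//= -[X in X + _]/(series _ N).
apply: (le_trans (lerD IH (lexx _))).
have p0 : 0 <= (2^-1 : R) ^+ N by exact: exprn_ge0.
have -> : (2 ^+ N.+1)^-1 = 2^-1 * 2^-1 ^+ N :> R by rewrite -exprVn exprS.
have [Nn|nN] := ltnP N n.
  rewrite (maxn_idPl Nn) exprS.
  by have := xye _ Nn; nra.
rewrite (maxn_idPr (leqW nN)) exprS.
by have := uval_dist_le1 (x N) (y N); nra.
Qed.

Lemma Omega_dist_coord x y n :
  `|uval (x n) - uval (y n)| <= 2 ^+ n.+1 * Omega_dist x y.
Proof.
rewrite mulrC -ler_pdivrMr ?exprn_gt0//.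
set u := fun i => `|uval (x i) - uval (y i)| / 2 ^+ i.+1.
have u0 i : 0 <= u i by rewrite divr_ge0 ?exprn_ge0.
have nd : nondecreasing_seq (series u) by apply: nondecreasing_series.
have := nondecreasing_cvgn_le nd (@is_cvg_Omega_dist R x y) n.+1.
by apply: le_trans; rewrite /series/= big_nat_recr//= lerDr sumr_ge0.
Qed.

Lemma coord_continuous n : continuous (fun x => uval (x n) : R).
Proof.
move=> x; apply/(@cvgrPdist_lt _ _ _ _ (nbhs_filter x)) => e e0.
have r0 : 0 < (2 ^+ n.+1)^-1 * e :> R by rewrite mulr_gt0 ?invr_gt0 ?exprn_gt0.
apply: filterS (nbhsx_ballx x _ r0) => y; rewrite ball_OmegaE/= => xy.
apply: le_lt_trans (Omega_dist_coord x y n) _.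
by rewrite -ltr_pdivlMl ?exprn_gt0.
Qed.

End Omega_topology.

(** * The Borel sets of the sequence space *)
Section Omega_borel.
Variable R : realType.
Implicit Types (x y : Omega R) (a b : unitI R).

Lemma measurable_uval : measurable_fun setT (@uval R).
Proof. by move=> _ B mB; exists B. Qed.

Lemma open_measurable_Omega (U : set (Omega R)) : open U -> measurable U.
Proof. exact: sub_sigma_algebra. Qed.

Lemma continuous_Omega_measurable (phi : Omega R -> R) :
  continuous phi -> measurable_fun setT phi.
Proof.
move=> /continuousP cphi; apply: (measurability _
  (measurable_realfun.RGenOpens.measurableE R)).
move=> _ [_ [a [b ->] <-]]; rewrite setTI; apply: open_measurable_Omega.
exact/cphi/interval_open.
Qed.

Lemma measurable_fun_unitI d (S : measurableType d) (h : S -> unitI R) :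
  measurable_fun setT (fun s => uval (h s)) -> measurable_fun setT h.
Proof.
move=> mh _ A [B mB <-]; rewrite [X in measurable X](_ : _ =
    setT `&` (fun s => uval (h s)) @^-1` B); first exact: mh.
by apply/seteqP; split=> s /=; tauto.
Qed.

Lemma measurable_coord n : measurable_fun setT (fun x => x n).
Proof.
apply: measurable_fun_unitI; apply: continuous_Omega_measurable.
exact: coord_continuous.
Qed.

(** The first [n] coordinates, rounded down to multiples of [2^-n]. *)
Definition grid n x : seq nat := mkseq (fun i =>
  Num.truncn (uval (x i) * 2 ^+ n)) n.

Lemma grid_dist n x y : grid n x = grid n y ->
  Omega_dist x y <= 2 * 2^-1 ^+ n.
Proof.
move=> gxy; rewrite mulr_natl mulr2n; apply: Omega_dist_le => [|i iN].
  exact: exprn_ge0.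
have := congr1 (fun s => nth 0%N s i) gxy; rewrite /grid !nth_mkseq// => h.
have p0 : 0 < (2 : R) ^+ n by exact: exprn_gt0.
have u0 z : 0 <= uval (z i : unitI R) * 2 ^+ n by rewrite mulr_ge0 ?uval_ge0//
  ltW.
have := truncn_itv (u0 x); have := truncn_itv (u0 y); rewrite h.
set k := (Num.truncn _) => /andP[y1 y2] /andP[x1 x2].
rewrite exprVn -[_^-1]mul1r ler_pdivlMr// -(gtr0_norm p0) -normrM mulrBl.
by rewrite ler_norml; move: y1 y2 x1 x2; rewrite -natr1; lra.
Qed.

(** The space is separable: every open set is a countable union of grid
    cells. *)
Lemma open_bigcup_grid (U : set (Omega R)) : open U ->
  U = \bigcup_(c in [set c : nat * seq nat | grid c.1 @^-1` [set c.2] `<=` U])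
        grid c.1 @^-1` [set c.2].
Proof.
move=> oU; apply/seteqP; split=> [x Ux|x [c cU gx]]; last exact: cU.
have /nbhs_ballP[e /= e0 xeU] : nbhs x U by exact: open_nbhs_nbhs.
have [n ne] : exists n, 2 * 2^-1 ^+ n < e.
  have : geometric (2 : R) 2^-1 @ \oo --> (0 : R).
    by apply: cvg_geometric; rewrite gtr0_norm// invf_lt1// ltr1n.
  move=> /cvgrPdist_lt/(_ _ e0)[n _ /(_ n (leqnn _))].
  by rewrite /= sub0r normrN ger0_norm ?mulr_ge0 ?exprn_ge0//; exists n.
exists (n, grid n x) => //= y /= gy; apply: xeU.
by rewrite ball_OmegaE /=; apply: le_lt_trans ne; exact: grid_dist.
Qed.

(** The measurable cylinders [A 0 x ... x A (n - 1) x Omega]. *)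
Definition cylinder n (A : nat -> set (unitI R)) : set (Omega R) :=
  [set x | forall i, (i < n)%N -> A i (x i)].

Definition cylinders : set (set (Omega R)) :=
  [set C | exists n A, (forall i, measurable (A i)) /\ C = cylinder n A].

Lemma cylinder_bigcap n A :
  cylinder n A = \bigcap_(i in `I_n) ((fun x => x i) @^-1` A i).
Proof. by apply/seteqP; split=> x h i; exact: h. Qed.

Lemma measurable_cylinder n A : (forall i, measurable (A i)) ->
  measurable (cylinder n A).
Proof.
move=> mA; rewrite cylinder_bigcap; apply: bigcap_measurableType => i _.
by rewrite -[X in measurable X]setTI; exact: measurable_coord.
Qed.

Lemma cylinder_widen n A N : (n <= N)%N ->
  cylinder N (fun i => if (i < n)%N then A i else setT) = cylinder n A.
Proof.
move=> nN; apply/seteqP; split=> x h i iN.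
  by have := h i (leq_trans iN nN); rewrite iN.
by case: ifPn => // /h.
Qed.

Lemma setI_closed_cylinders : setI_closed cylinders.
Proof.
move=> _ _ [n [A [mA ->]]] [m [B [mB ->]]].
exists (maxn n m), (fun i => (if (i < n)%N then A i else setT) `&`
                             (if (i < m)%N then B i else setT)); split.
  by move=> i; apply: measurableI; case: ifP.
rewrite -(cylinder_widen A (leq_maxl n m)) -(cylinder_widen B (leq_maxr n m)).
apply/seteqP; split=> [x [Ax Bx] i iN|x ABx]; first by split;
  [exact: Ax|exact: Bx].
by split=> i /ABx[].
Qed.

(** A grid cell is a cylinder, unless the sequence of indices does not have
    length [n], in which case the cell is empty. *)
Lemma grid_cell_cylinder (c : nat * seq nat) :
  grid c.1 @^-1` [set c.2] = set0 \/
  cylinders (grid c.1 @^-1` [set c.2]).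
Proof.
case: c => n s /=; have [sn|sn] := eqVneq (size s) n; last first.
  left; apply/seteqP; split=> x //= gx.
  by move: sn; rewrite -gx size_mkseq eqxx.
right; exists n, (fun i => [set a | Num.truncn (uval a * 2 ^+ n) =
  nth 0%N s i]).
split=> [i|].
  set k := nth 0%N s i.
  rewrite [X in measurable X](_ : _ = setT `&`
      @uval R @^-1` [set` `[k%:R / 2 ^+ n, k.+1%:R / 2 ^+ n[]).
    by apply: measurable_uval => //; exact: measurable_itv.
  have p0 : 0 < (2 : R) ^+ n by exact: exprn_gt0.
  rewrite setTI; apply/seteqP; split=> a /=.
    move=> <-; rewrite in_itv/= ler_pdivrMr// ltr_pdivlMr//.
    by apply: truncn_itv; rewrite mulr_ge0 ?uval_ge0// ltW.
  by rewrite in_itv/= ler_pdivrMr// ltr_pdivlMr// => /truncn_def.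
apply/seteqP; split=> [x /= <- i iN|x h]; first by rewrite /= /grid nth_mkseq.
apply: (@eq_from_nth _ 0%N); rewrite size_mkseq// => i iN.
by rewrite nth_mkseq// h.
Qed.

End Omega_borel.

Section Omega_borel_cylinders.
Variable R : realType.
Implicit Types (x y : Omega R) (a b : unitI R).

Lemma measurable_fun_Omega d (S : measurableType d) (h : S -> Omega R) :
  (forall n, measurable_fun setT (fun s => h s n)) -> measurable_fun setT h.
Proof.
move=> mh; apply: (@measurability _ _ _ _ _ _ (@open (Omega R))) => //.
move=> _ [U oU <-]; rewrite setTI (open_bigcup_grid oU) preimage_bigcup.
rewrite bigcup_mkcond; apply: countable_bigcupT_measurable => // c.
case: ifP => // _; have [->|[n [A [mA ->]]]] := grid_cell_cylinder R c.
  by rewrite preimage_set0.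
rewrite cylinder_bigcap preimage_bigcap; apply: bigcap_measurableType => i _.
by rewrite -[X in measurable X]setTI; exact: mh.
Qed.

Lemma measurable_OmegaE :
  @measurable _ (Omega R) = <<s @cylinders R >>.
Proof.
apply/seteqP; split; apply: smallest_sub.
- exact: smallest_sigma_algebra.
- move=> U oU; rewrite (open_bigcup_grid oU) bigcup_mkcond.
  apply: (@countable_bigcupT_measurable _ (g_sigma_algebraType (@cylinders R)))
    => // c.
  case: ifP => // _; have [->|?] := grid_cell_cylinder R c => //.
  exact: sub_sigma_algebra.
- exact: sigma_algebra_measurable.
- by move=> _ [n [A [mA ->]]]; exact: measurable_cylinder.
Qed.

Lemma measurable_ocons :
  measurable_fun setT (fun p : unitI R * Omega R => ocons p.1 p.2).
Proof.
apply: measurable_fun_Omega => -[|n] /=; first exact: measurable_fst.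
exact: (measurableT_comp (@measurable_coord R n) (@measurable_snd _ _ _ _)).
Qed.

Lemma measurable_oconsl x : measurable_fun setT (fun a => ocons a x).
Proof.
exact: (measurableT_comp measurable_ocons (measurable_pair2 x)).
Qed.

Lemma measurable_oconsr a : measurable_fun setT (ocons a).
Proof.
exact: (measurableT_comp measurable_ocons (measurable_pair1 a)).
Qed.

(** Two finite measures that agree on cylinders are equal. *)
Lemma cylinder_measure_unique (m1 m2 : {measure set (Omega R) -> \bar R}) :
  (m1 setT < +oo)%E ->
  (forall n A, (forall i, measurable (A i)) ->
    m1 (cylinder n A) = m2 (cylinder n A)) ->
  forall A, measurable A -> m1 A = m2 A.
Proof.
move=> m1oo m12; apply: (measure_unique (@cylinders R) (fun=> setT)).
- exact: measurable_OmegaE.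
- exact: setI_closed_cylinders.
- by move=> _; exists 0%N, (fun=> setT); split=> //; apply/seteqP; split.
- by rewrite bigcup_const//; exists 0%N.
- by move=> _ [n [A [mA ->]]]; exact: m12.
- by [].
Qed.

Lemma clamp_subproof (r : R) : 0 <= Num.max 0 (Num.min r 1) <= 1.
Proof. by rewrite le_max lexx/= ge_max ler01 ge_min lexx orbT. Qed.

(** The nearest point of the unit interval. *)
Definition clamp (r : R) : unitI R :=
  exist (fun s : R => 0 <= s <= 1) _ (clamp_subproof r).

Lemma clampK a : clamp (uval a) = a.
Proof.
apply: uval_inj; rewrite /uval/= -/(uval a).
by rewrite (min_idPl (uval_le1 a)) (max_idPr (uval_ge0 a)).
Qed.

Lemma clamp_lip (r s : R) : `|uval (clamp r) - uval (clamp s)| <= `|r - s|.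
Proof.
rewrite /uval/= /Num.max /Num.min.
have := ler_norm (r - s); have := lerNnormlW (lexx `|r - s|).
by do 2 (case: ifP; case: ifP); rewrite ?ltNge; move=> *; rewrite ler_norml;
  lra.
Qed.

(** The space is the image of a product of segments, compact by Tychonoff, under
    the coordinatewise projection onto the unit interval. *)
Lemma compact_Omega : compact [set: Omega R].
Proof.
pose K := [set g : forall _ : nat, R | forall i, `[0, 1]%classic (g i)].
have cK : compact (K : set (prod_topology (fun=> R))).
  exact: (@tychonoff _ (fun=> R) _ (fun=> @segment_compact R 0 1)).
pose h (g : prod_topology (fun _ : nat => R)) : Omega R := fun n => clamp (g n).
have -> : [set: Omega R] = h @` K.
  apply/seteqP; split=> // x _; exists (fun n => uval (x n)) => /=.
    by move=> i /=; rewrite in_itv/= uval_ge0 uval_le1.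
  by apply/funext => n; exact: clampK.
apply: continuous_compact cK; apply: continuous_subspaceT => g.
move=> U /nbhs_ballP[e /= e0 eU].
suff : nbhs g (h @^-1` ball (h g) e) by apply: filterS => g'; exact: eU.
have [n ne] : exists n, (2^-1 : R) ^+ n < e / 2.
  have : geometric (1 : R) 2^-1 @ \oo --> (0 : R).
    by apply: cvg_geometric; rewrite gtr0_norm// invf_lt1// ltr1n.
  have e2 : 0 < e / 2 by rewrite divr_gt0.
  move=> /cvgrPdist_lt/(_ _ e2)[n _ /(_ n (leqnn _))].
  by rewrite /= mul1r sub0r normrN ger0_norm ?exprn_ge0//; exists n.
have : \forall g' \near g, forall i, (i < n)%N -> `|g i - g' i| <= e / 2.
  elim: n {ne} => [|n IH]; first exact: (@filterE _ _ (nbhs_filter g)).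
  have gn : \forall g' \near g, `|g n - g' n| <= e / 2.
    have /(@cvgrPdist_le _ _ _ _ (nbhs_filter g)) :=
      @proj_continuous _ (fun _ : nat => R) n g.
    by apply; rewrite divr_gt0.
  apply: filterS2 gn IH => g' gn IH i; rewrite ltnS leq_eqVlt =>
    /predU1P[->//|].
  exact: IH.
apply: filterS => g' gg'; rewrite /= ball_OmegaE/=.
apply: (@le_lt_trans _ _ (e / 2 + 2^-1 ^+ n));
  last by rewrite [ltRHS](splitr e) ltrD2l.
apply: Omega_dist_le => [|i iN]; first by rewrite divr_ge0// ltW.
exact: le_trans (clamp_lip _ _) (gg' i iN).
Qed.

Lemma continuous_Omega_bounded (phi : Omega R -> R) : continuous phi ->
  exists C, forall x, `|phi x| <= C.
Proof.
move=> cphi; have : compact (phi @` setT).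
  by apply: continuous_compact compact_Omega; exact: continuous_subspaceT.
move=> /compact_bounded[M [_ Mphi]]; exists (M + 1) => x.
by apply: (Mphi (M + 1)); [rewrite ltrDl|exists x].
Qed.

End Omega_borel_cylinders.

Section as_probability.
Context d (T : measurableType d) (R : realType).
Variables (mu : {measure set T -> \bar R}) (mu1 : mu setT = 1%E).

(** A measure of total mass [1], with its structure of probability. *)
Definition as_probability (_ : mu setT = 1%E) (A : set T) := mu A.

HB.instance Definition _ := Measure.on (as_probability mu1).
HB.instance Definition _ :=
  Measure_isProbability.Build _ _ _ (as_probability mu1) mu1.

End as_probability.

(** * Existence of the infinite product of a probability on the unit interval *)
Section finite_depth.
Variable R : realType.
Implicit Types (A B : set (Omega R)) (x y : Omega R) (a b : unitI R).

(** [phi] only depends on the first [n] coordinates. It is applied both to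
    functions and to sets, a set being a [Prop]-valued function. *)
Definition finite_depth T n (phi : Omega R -> T) :=
  forall x y, (forall i, (i < n)%N -> x i = y i) -> phi x = phi y.

Lemma finite_depth_widen T n k (phi : Omega R -> T) :
  (n <= k)%N -> finite_depth n phi -> finite_depth k phi.
Proof.
by move=> nk dphi x y xy; apply: dphi => i /leq_trans/(_ nk); exact: xy.
Qed.

Lemma finite_depth_section T n (phi : Omega R -> T) a :
  finite_depth n.+1 phi -> finite_depth n (fun x => phi (ocons a x)).
Proof.
by move=> dphi x y xy; apply: dphi => -[|i]//=; rewrite ltnS; exact: xy.
Qed.

Lemma finite_depth_cst T n (c : T) : finite_depth n (fun=> c).
Proof. by []. Qed.

Lemma finite_depth_setC n A : finite_depth n A -> finite_depth n (~` A).
Proof. by move=> dA x y xy; rewrite /setC/mkset (dA _ _ xy). Qed.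

Lemma finite_depth_setU n A B :
  finite_depth n A -> finite_depth n B -> finite_depth n (A `|` B).
Proof. by move=> dA dB x y xy; rewrite /setU/mkset (dA _ _ xy) (dB _ _ xy). Qed.

Lemma finite_depth_indic n A :
  finite_depth n A -> finite_depth n (fun x => (\1_A x)%:E : \bar R).
Proof.
move=> dA x y xy; rewrite !indicE; have -> // : (x \in A) = (y \in A).
by apply/idP/idP => /set_mem Az; apply/mem_set; move: Az; rewrite (dA _ _ xy).
Qed.

Lemma finite_depth_cylinder n (A : nat -> set (unitI R)) :
  finite_depth n (cylinder n A).
Proof.
move=> x y xy; apply/propext; split=> h i iN; move: (h i iN).
  by rewrite xy.
by rewrite -xy.
Qed.

(** The algebra of measurable sets of finite depth. *)
Definition cyl_measurable (A : set (Omega R)) :=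
  measurable A /\ exists n, finite_depth n A.

(** The sequence space, carrying this algebra instead of its Borel sets. *)
Definition cylType : Type := Omega R.

HB.instance Definition _ := Pointed.on cylType.

Definition cyl_display : Type -> measure_display. Proof. exact. Qed.

Let cyl_measurable0 : cyl_measurable set0.
Proof. by split=> //; exists 0%N; exact: finite_depth_cst. Qed.

Let cyl_measurableU : setU_closed cyl_measurable.
Proof.
move=> A B [mA [n dA]] [mB [k dB]]; split; first exact: measurableU.
exists (maxn n k); apply: finite_depth_setU.
  by apply: finite_depth_widen dA; exact: leq_maxl.
by apply: finite_depth_widen dB; exact: leq_maxr.
Qed.

Let cyl_measurableC : setC_closed cyl_measurable.
Proof.
move=> A [mA [n dA]]; split; first exact: measurableC.
by exists n; exact: finite_depth_setC.
Qed.

HB.instance Definition _ := isAlgebraOfSets.Build (cyl_display R) cylType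
  cyl_measurable0 cyl_measurableU cyl_measurableC.

End finite_depth.

Section iterated_integral.
Variables (R : realType) (m : probability (unitI R) R).
Implicit Types (A B : set (Omega R)) (x y : Omega R) (a b : unitI R)
  (phi psi : Omega R -> \bar R).

Local Open Scope ereal_scope.

(** Integration of the first [n] coordinates against [m], the remaining ones
    being set to a default value. *)
Fixpoint itint n phi : \bar R :=
  if n is k.+1 then \int[m]_a itint k (fun x => phi (ocons a x)) else phi point.

Lemma itint_ge0 n phi : (forall x, 0 <= phi x) -> 0 <= itint n phi.
Proof.
elim: n phi => [|n IH] phi phi0 /=; first exact: phi0.
by apply: integral_ge0 => a _; exact: IH.
Qed.

(** The parameter space is arbitrary, so that the induction on [n] can move the
    integrated coordinate into the parameter. *)
Lemma measurable_itint n d (S : measurableType d)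
    (phi : S * Omega R -> \bar R) :
  measurable_fun setT phi -> (forall p, 0 <= phi p) ->
  measurable_fun setT (fun s => itint n (fun x => phi (s, x))).
Proof.
elim: n d S phi => [|n IH] d S phi mphi phi0 /=.
  exact: (measurableT_comp mphi (measurable_pair2 point)).
pose psi (p : (S * unitI R) * Omega R) := phi (p.1.1, ocons p.1.2 p.2).
apply: (measurable_fun_fubini_tonelli_F
  (fun p : S * unitI R => itint n (fun x => psi (p, x)))).
  apply: IH => [|p]; last exact: phi0.
  apply: (measurableT_comp mphi); apply/measurable_fun_pairP; split => /=.
    exact: (measurableT_comp measurable_fst measurable_fst).
  have mp : measurable_fun setT
      (fun p : (S * unitI R) * Omega R => (p.1.2, p.2)).
    apply/measurable_fun_pairP; split => /=; last exact: measurable_snd.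
    exact: (measurableT_comp measurable_snd measurable_fst).
  exact: (measurableT_comp (@measurable_ocons R) mp).
by move=> p; apply: itint_ge0 => x; exact: phi0.
Qed.

Lemma measurable_itint_section n phi :
  measurable_fun setT phi -> (forall x, 0 <= phi x) ->
  measurable_fun setT (fun a => itint n (fun x => phi (ocons a x))).
Proof.
move=> mphi phi0.
apply: (@measurable_itint n _ _ (fun p => phi (ocons p.1 p.2))) => //.
exact: measurableT_comp mphi (@measurable_ocons R).
Qed.

Lemma itintD n phi psi :
  measurable_fun setT phi -> measurable_fun setT psi ->
  (forall x, 0 <= phi x) -> (forall x, 0 <= psi x) ->
  itint n (fun x => phi x + psi x) = itint n phi + itint n psi.
Proof.
elim: n phi psi => [//|n IH] phi psi mphi mpsi phi0 psi0 /=.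
rewrite -ge0_integralD//.
- apply: eq_integral => a _; apply: IH => //.
    exact: measurableT_comp mphi (measurable_oconsr a).
  exact: measurableT_comp mpsi (measurable_oconsr a).
- by move=> a _; exact: itint_ge0.
- exact: measurable_itint_section.
- by move=> a _; exact: itint_ge0.
- exact: measurable_itint_section.
Qed.

Lemma itint_cst n c : itint n (fun=> c) = c.
Proof.
elim: n => //= n IH; under eq_integral do rewrite IH.
by rewrite integral_cst// [X in _ * X]probability_setT mule1.
Qed.

(** Integrating more coordinates than [phi] depends on changes nothing, [m]
    being a probability. *)
Lemma itint_depth n k phi :
  finite_depth n phi -> (n <= k)%N -> itint k phi = itint n phi.
Proof.
elim: n k phi => [|n IH] k phi dphi nk.
  by rewrite (_ : phi = fun=> phi point) ?itint_cst//; apply/funext => x;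
    exact: dphi.
case: k nk => // k nk /=; apply: eq_integral => a _; apply: IH => //.
exact: finite_depth_section.
Qed.

(** The product measure on sets of finite depth: as many coordinates are
    integrated as a depth of the set, which depth being immaterial. *)
Definition cylm (A : set (cylType R)) : \bar R :=
  itint (xget 0%N [set n | finite_depth n A]) (fun x => (\1_A x)%:E).

Lemma cylmE n A : finite_depth n A -> cylm A = itint n (fun x => (\1_A x)%:E).
Proof.
move=> dA; rewrite /cylm; set k := xget _ _.
have dk : finite_depth k A.
  by apply: (@xgetPex _ 0%N [set n | finite_depth n A]); exists n.
have [nk|/ltnW kn] := leqP n k; first exact/itint_depth/nk/finite_depth_indic.
exact/esym/itint_depth/kn/finite_depth_indic.
Qed.

Lemma cylm0 : cylm set0 = 0.
Proof.
rewrite (@cylmE 0%N) //= ?indicE ?in_set0//; exact: finite_depth_cst.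
Qed.

Lemma cylm_ge0 A : 0 <= cylm A.
Proof. by apply: itint_ge0 => x; rewrite lee_fin. Qed.

Lemma cylmU A B : cyl_measurable A -> cyl_measurable B -> A `&` B = set0 ->
  cylm (A `|` B) = cylm A + cylm B.
Proof.
move=> [mA [n dA]] [mB [k dB]] AB.
have dA' := finite_depth_widen (leq_maxl n k) dA.
have dB' := finite_depth_widen (leq_maxr n k) dB.
rewrite (cylmE dA') (cylmE dB') (cylmE (finite_depth_setU dA' dB')) -itintD//.
- congr itint; apply/funext => x; rewrite !indicE in_setU -EFinD.
  have [/set_mem Ax|_] := boolP (x \in A); last by rewrite add0r.
  have [/set_mem Bx|_] := boolP (x \in B); last by rewrite addr0.
  by have : (A `&` B) x by []; rewrite AB.
- exact/measurable_EFinP.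
- exact/measurable_EFinP.
Qed.

Lemma cylm_le1 A : cyl_measurable A -> cylm A <= 1.
Proof.
move=> mA; have <- : cylm setT = 1.
  rewrite (@cylmE 0%N) /= ?indicE ?in_setT//; exact: finite_depth_cst.
rewrite -(setUv A) cylmU ?setICr//; first by rewrite leeDl// cylm_ge0.
exact: (@measurableC _ (cylType R)).
Qed.

Lemma cylm_section A n : finite_depth n A ->
  cylm A = \int[m]_a cylm (ocons a @^-1` A).
Proof.
move=> dA; have dA1 := finite_depth_widen (leqnSn n) dA.
rewrite (cylmE dA1) /=; apply: eq_integral => a _.
by rewrite (cylmE (finite_depth_section a dA1)).
Qed.

Lemma cyl_measurable_section a (A : set (Omega R)) :
  cyl_measurable A -> cyl_measurable (ocons a @^-1` A).
Proof.
move=> [mA [n dA]]; split.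
  by rewrite -[X in measurable X]setTI; exact: measurable_oconsr.
exists n; apply: finite_depth_section.
exact: finite_depth_widen (leqnSn n) dA.
Qed.

Lemma measurable_cylm_section A : cyl_measurable A ->
  measurable_fun setT (fun a => cylm (ocons a @^-1` A)).
Proof.
move=> [mA [n dA]]; rewrite [X in measurable_fun _ X](_ : _ =
    fun a => itint n (fun x => (\1_A (ocons a x))%:E)); last first.
  apply/funext => a; rewrite (@cylmE n)//; apply: finite_depth_section.
  exact: finite_depth_widen (leqnSn n) dA.
apply: (@measurable_itint_section n (fun x => (\1_A x)%:E)).
  exact/measurable_EFinP.
by move=> x; rewrite lee_fin.
Qed.

(** If every section of the sets [F k] at their first coordinate has a measure
    tending to [0], so have the sets [F k] themselves. *)
Lemma cylm_section_cvg0 (F : nat -> set (Omega R)) :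
  (forall k, cyl_measurable (F k)) ->
  (forall a, cylm (ocons a @^-1` F k) @[k --> \oo] --> 0) ->
  cylm (F k) @[k --> \oo] --> 0.
Proof.
move=> mF F0; have -> : (fun k => cylm (F k)) =
    fun k => \int[m]_a cylm (ocons a @^-1` F k).
  by apply/funext => k; have [_ [n dn]] := mF k; exact: cylm_section dn.
have -> : 0 = \int[m]_a (cst 0 a) :> \bar R by rewrite integral_cst// mul0e.
have [] // := @dominated_convergence _ _ _ m _ measurableT
  (fun k a => cylm (ocons a @^-1` F k)) (cst 0) (cst 1).
- by move=> k; exact: measurable_cylm_section.
- by apply: aeW => a _; exact: F0.
- exact: finite_measure_integrable_cst.
- apply: aeW => a k _ /=; rewrite gee0_abs ?cylm_ge0//; apply: cylm_le1.
  exact: cyl_measurable_section.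
Qed.

(** Continuity at the empty set. If the measures of the decreasing sets [F k]
    did not tend to [0], coordinates could be chosen one after the other such
    that the measures of the successive sections still do not tend to [0]; as
    each [F k] has finite depth, the sequence so chosen lies in all [F k]. *)
Lemma cylm_cvg0 (F : nat -> set (Omega R)) :
  (forall k, cyl_measurable (F k)) ->
  (forall k l, (k <= l)%N -> F l `<=` F k) ->
  \bigcap_k F k = set0 -> cylm (F k) @[k --> \oo] --> 0.
Proof.
move=> mF ndF F0; apply: contrapT => nF.
pose good (G : nat -> set (Omega R)) :=
  (forall k, cyl_measurable (G k)) /\ ~ (cylm (G k) @[k --> \oo] --> 0).
pose sec a (G : nat -> set (Omega R)) := fun k => ocons a @^-1` G k.
have good_sec G : good G -> exists a, good (sec a G).
  move=> [mG nG]; apply: contrapT => /forallNP ngood; apply: nG.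
  apply: cylm_section_cvg0 => // a; apply: contrapT => nGa; apply: (ngood a).
  by split=> // k; exact: cyl_measurable_section.
pose pick G := xget point [set a | good (sec a G)].
pose G := fix G j := if j is i.+1 then sec (pick (G i)) (G i) else F.
have goodG j : good (G j).
  by elim: j => [//|j IH] /=; have /(xgetPex point) := good_sec _ IH.
pose x : Omega R := fun j => pick (G j).
have GE j k y : G j k y = F k (fun i => if (i < j)%N then x i else y (i - j)%N).
  elim: j y => [|j IH] y /=; first by congr F; apply/funext => i; rewrite subn0.
  rewrite /sec /preimage/= IH; congr F; apply/funext => i.
  rewrite [in RHS]ltnS [in RHS]leq_eqVlt; case: (ltngtP i j) => [//|ji|->];
    last by rewrite subnn.
  by rewrite /= -(subnSK ji).
suff : (\bigcap_k F k) x by rewrite F0.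
move=> k _; apply: contrapT => nFx; have [_ [n dn]] := mF k.
have Gn0 l : (k <= l)%N -> G n l = set0.
  move=> kl; apply/seteqP; split=> // y; rewrite GE => /(ndF _ _ kl).
  by rewrite (dn _ x) // => i ->.
apply: (goodG n).2; apply: cvg_near_cst.
by exists k => // l /= kl; rewrite Gn0// cylm0.
Qed.

(* The value at a disjoint union is the sum of the first [n] values and of the
   value at the rest [B n], which decreases to the empty set. *)
Let cylm_sigma_additive : semi_sigma_additive cylm.
Proof.
move=> F mF tF mUF.
pose B n := (\bigcup_k F k) `\` \big[setU/set0]_(i < n) F i.
have mB n : measurable (B n : set (cylType R)).
  by apply: measurableD => //; apply: bigsetU_measurable.
have BS n : cylm (B n) = cylm (F n) + cylm (B n.+1).
  rewrite -cylmU.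
  - congr cylm; apply/seteqP; split=> x.
    + move=> [Ux nx]; have [Fx|nFx] := pselect (F n x); [by left|right].
      by split=> //; rewrite big_ord_recr/= => -[].
    + move=> [Fx|[Ux]].
        split; first by exists n.
        rewrite -bigcup_mkord => -[i /= iN Fix].
        have := tF i n Logic.I Logic.I.
        move=> /(_ (ex_intro _ x (conj Fix Fx))).
        by move=> iE; rewrite iE ltnn in iN.
      by rewrite big_ord_recr/= => nx; split=> // ?; apply: nx; left.
  - exact: mF.
  - exact: mB.
  - apply/seteqP; split=> // x [Fx [_]]; rewrite big_ord_recr/=; apply.
    by right.
have UE n : cylm (\bigcup_k F k) = \sum_(0 <= i < n) cylm (F i) + cylm (B n).
  elim: n => [|n IH]; first by rewrite big_geq// add0e /B big_ord0 setD0.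
  by rewrite big_nat_recr//= IH BS addeA.
have finB n : cylm (B n) \is a fin_num.
  rewrite ge0_fin_numE ?cylm_ge0//; apply: le_lt_trans (ltry 1).
  exact: cylm_le1 (mB n).
have -> : (fun n => \sum_(0 <= i < n) cylm (F i)) =
    fun n => cylm (\bigcup_k F k) - cylm (B n).
  by apply/funext => n; rewrite (UE n) addeK.
rewrite -[X in _ --> X]sube0; apply: cvgeB;
  [by rewrite fin_num_adde_defl ?fin_numN|exact: cvg_cst|].
apply: cylm_cvg0 => [//|k l kl|].
  move=> x [Ux nx]; split=> //; apply: contra_not nx.
  by apply: subset_bigsetU.
apply/seteqP; split=> // x Bx; have [[i _ Fix] _] := Bx 0%N Logic.I.
have [_] := Bx i.+1 Logic.I; apply; rewrite big_ord_recr/=.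
by right.
Qed.

HB.instance Definition _ := isMeasure.Build _ _ _ cylm
  cylm0 cylm_ge0 cylm_sigma_additive.

Lemma itint_cylinder n (A : nat -> set (unitI R)) :
  (forall i, measurable (A i)) ->
  itint n (fun x => (\1_(cylinder n A) x)%:E) = \prod_(i < n) m (A i).
Proof.
elim: n A => [|n IH] A mA /=; first by rewrite big_ord0 indicE mem_set.
rewrite big_ord_recl/= -(IH (fun i => A i.+1))//; set K := itint _ _.
have K0 : 0 <= K by apply: itint_ge0 => x; rewrite lee_fin.
transitivity (\int[m]_a ((\1_(A 0%N) a)%:E * K)).
  apply: eq_integral => a _; rewrite indicE.
  have [/set_mem Aa|nAa] := boolP (a \in A 0%N).
    rewrite mul1e; congr itint; apply/funext => x; rewrite !indicE.
    congr ((nat_of_bool _)%:R%:E); apply/idP/idP => /set_mem h; apply/mem_set.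
      by move=> i iN; exact: (h i.+1).
    by move=> [|i] // iN; exact: h.
  rewrite mul0e -[RHS](itint_cst n 0); congr itint; apply/funext => x.
  rewrite indicE memNset// => /(_ 0%N isT) h.
  by move: nAa; rewrite notin_setE.
rewrite ge0_integralZr//; last by apply/measurable_EFinP.
by rewrite integral_indic// setIT.
Qed.

(** The infinite product of a probability on the unit interval. *)
Lemma product_probability_exists : exists P : probability (Omega R) R,
  forall n (A : nat -> set (unitI R)), (forall i, measurable (A i)) ->
    P (cylinder n A) = \prod_(i < n) m (A i).
Proof.
pose mu : {measure set _ -> \bar R} := measure_extension cylm.
pose T := g_sigma_algebraType (@measurable _ (cylType R)).
have cyl_cylinder n (A : nat -> set (unitI R)) : (forall i, measurable (A i)) ->
    cyl_measurable (cylinder n A).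
  move=> mA; split; first exact: measurable_cylinder.
  by exists n; exact: finite_depth_cylinder.
pose h : T -> Omega R := idfun.
have mh : measurable_fun setT h.
  apply: (measurability _ (measurable_OmegaE R)) => _ [_ [n [A [mA ->]]] <-].
  rewrite setTI; apply: sub_sigma_algebra; exact: cyl_cylinder.
pose P1 : {measure set (Omega R) -> \bar R} := pushforward mu h.
pose P0 := P1 mh.
have P0E n (A : nat -> set (unitI R)) : (forall i, measurable (A i)) ->
    P0 (cylinder n A) = \prod_(i < n) m (A i).
  move=> mA; rewrite /P0/P1/= /pushforward /mu/= /measure_extension.
  rewrite measurable_mu_extE/=; last exact: cyl_cylinder.
  by rewrite (@cylmE n) ?itint_cylinder//; exact: finite_depth_cylinder.
have P0T : P0 setT = 1.
  have := P0E 0%N (fun=> setT) (fun=> measurableT); rewrite big_ord0 => <-.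
  by congr (P0 _); apply/seteqP; split.
by exists (as_probability P0T).
Qed.

End iterated_integral.

(** * Measures given by a density *)
Section density.
Context d (T : measurableType d) (R : realType).
Variables (mu : {measure set T -> \bar R}) (w : T -> R).
Hypotheses (mw : measurable_fun setT w) (w0 : forall x, 0 <= w x).

Local Open Scope ereal_scope.

(** The measure with density [w] with respect to [mu]. *)
Definition density (_ : measurable_fun setT w) (_ : forall x, (0 <= w x)%R)
  (A : set T) := \int[mu]_(x in A) (w x)%:E.

Let nu := density mw w0.

Let density0 : nu set0 = 0.
Proof. exact: integral_set0. Qed.

Let density_ge0 A : 0 <= nu A.
Proof. by apply: integral_ge0 => x _; rewrite lee_fin. Qed.

Let density_sigma_additive : semi_sigma_additive nu.
Proof.
apply: semi_sigma_additive_nng_induced => [|x]; first exact/measurable_EFinP.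
by rewrite lee_fin.
Qed.

HB.instance Definition _ := isMeasure.Build _ _ _ nu
  density0 density_ge0 density_sigma_additive.

Import HBNNSimple.

(** Change of density, by monotone approximation by simple functions. *)
Lemma ge0_integral_density (phi : T -> \bar R) :
  measurable_fun setT phi -> (forall x, 0 <= phi x) ->
  \int[nu]_x phi x = \int[mu]_x (phi x * (w x)%:E).
Proof.
move=> mphi phi0; pose h := nnsfun_approx measurableT mphi.
have hphi x : (EFin \o h n) x @[n --> \oo] --> phi x.
  exact: cvg_nnsfun_approx.
have ndh x : nondecreasing_seq (fun n => (EFin \o h n) x).
  by move=> a b ab; rewrite lee_fin; exact/lefP/nd_nnsfun_approx.
have mh n : measurable_fun setT (EFin \o h n) by exact/measurable_EFinP.
have w0' x : 0 <= (w x)%:E by rewrite lee_fin.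
have h0 n x : 0 <= (EFin \o h n) x by rewrite lee_fin.
have hn n : \int[nu]_x (EFin \o h n) x =
    \int[mu]_x ((EFin \o h n) x * (w x)%:E).
  rewrite integralT_nnsfun sintegralE.
  under [RHS]eq_integral => x _.
    rewrite /= (fimfunE (h n) x) -fsumEFin// ge0_mule_fsuml; last first.
      by move=> y; exact: nnfun_muleindic_ge0.
    over.
  rewrite ge0_integral_fsum//.
  - apply: eq_fsbigr => y yh.
    have y0 : (0 <= y)%R by move: yh; rewrite inE => -[t _ <-].
    transitivity (\int[mu]_x (y%:E * ((w \_ (h n @^-1` [set y])) x)%:E));
      last first.
      apply: eq_integral => x _; rewrite patchE indicE.
      by case: ifP => _ /=; rewrite ?mulr1 ?mulr0 ?mul0e ?mule0.
    rewrite ge0_integralZl//.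
    + congr (_ * _); rewrite /nu/= /density [LHS]integral_mkcond.
      by apply: eq_integral => x _; rewrite !patchE; case: ifP.
    + apply/measurable_EFinP; apply/(measurable_restrictT _ _).1 => //.
      exact: measurable_funTS.
    + by move=> x _; rewrite lee_fin patchE; case: ifP.
  - move=> y; apply: emeasurable_funM; last exact/measurable_EFinP.
    by apply/measurable_EFinP; exact: measurable_funM.
  - by move=> y x _; rewrite mule_ge0// nnfun_muleindic_ge0.
transitivity (limn (fun n => \int[nu]_x (EFin \o h n) x)).
  rewrite -monotone_convergence//.
  by apply: eq_integral => x _; exact/esym/cvg_lim/hphi.
transitivity (limn (fun n => \int[mu]_x ((EFin \o h n) x * (w x)%:E))).
  by congr (limn _); apply/funext => n; exact: hn.
rewrite -monotone_convergence//.
- apply: eq_integral => x _; apply/cvg_lim => //; exact: cvgeZr.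
- by move=> n; apply: emeasurable_funM => //; exact/measurable_EFinP.
- by move=> n x _; exact: mule_ge0.
- by move=> x _ a b ab; apply: lee_wpmul2r => //; exact: ndh.
Qed.

Lemma integral_density (phi : T -> R) : measurable_fun setT phi ->
  \int[nu]_x (phi x)%:E = \int[mu]_x (phi x * w x)%:E.
Proof.
move=> mphi; have mE : measurable_fun setT (EFin \o phi) by
  exact/measurable_EFinP.
rewrite [LHS]integralE [RHS]integralE; congr (_ - _).
- rewrite ge0_integral_density//; last exact: measurable_funepos.
  apply: eq_integral => x _; rewrite !funeposE -!EFin_max -EFinM.
  by rewrite maxr_pMl// mul0r.
- rewrite ge0_integral_density//; last exact: measurable_funeneg.
  apply: eq_integral => x _; rewrite !funenegE -!EFinN -!EFin_max -EFinM.
  by rewrite maxr_pMl// mul0r mulNr.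
Qed.

End density.

(** * Integration against a product measure *)
Section product_integral.
Variables (R : realType) (m : probability (unitI R) R)
          (P : probability (Omega R) R).

Local Open Scope ereal_scope.

Hypothesis PE : forall n (A : nat -> set (unitI R)),
  (forall i, measurable (A i)) -> P (cylinder n A) = \prod_(i < n) m (A i).

(** [P] is the law of the sequence obtained by adding an independent
    coordinate of law [m] in front of a sequence of law [P]. *)
Lemma pushforward_ocons (A : set (Omega R)) : measurable A ->
  pushforward (m \x P) (fun p => ocons p.1 p.2) A = P A.
Proof.
pose Q' : {measure set (Omega R) -> \bar R} :=
  pushforward (m \x P) (fun p : unitI R * Omega R => ocons p.1 p.2).
pose Q := Q' (@measurable_ocons R).
suff : forall A, measurable A -> P A = Q A by move=> h mA; rewrite h.
apply: cylinder_measure_unique => [|n {}A mA].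
  by rewrite [X in X < _]probability_setT ltry.
rewrite [LHS]PE// /Q/Q'/= /pushforward; case: n => [|n].
  rewrite big_ord0 [X in _ = _ X](_ : _ = setT `*` setT); last first.
    by apply/seteqP; split=> // x _ [].
  by rewrite product_measure1E// [X in X * _]probability_setT
     [X in _ * X]probability_setT mule1.
rewrite [X in _ = _ X](_ : _ = A 0%N `*` cylinder n (fun i => A i.+1)).
  rewrite product_measure1E//; last exact: measurable_cylinder.
  by rewrite [X in _ * X]PE// big_ord_recl.
apply/seteqP; split=> [[a x] /= h|[a x] [/= h0 h] [|i]//= iN].
  by split=> [|i iN]; [exact: (h 0%N)|exact: (h i.+1)].
exact: h.
Qed.

Lemma ge0_integral_ocons (phi : Omega R -> \bar R) :
  measurable_fun setT phi -> (forall x, 0 <= phi x) ->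
  \int[P]_x phi x = \int[P]_x \int[m]_a phi (ocons a x).
Proof.
move=> mphi phi0.
pose Q' : {measure set (Omega R) -> \bar R} :=
  pushforward (m \x P) (fun p : unitI R * Omega R => ocons p.1 p.2).
transitivity (\int[Q' (@measurable_ocons R)]_x phi x).
  by apply: eq_measure_integral => A mA _; exact/esym/pushforward_ocons.
rewrite ge0_integral_pushforward//; last exact: measurable_ocons.
rewrite preimage_setT fubini_tonelli2// => [|p]; last exact: phi0.
exact: measurableT_comp mphi (@measurable_ocons R).
Qed.

Lemma bounded_integrable d (T : measurableType d)
    (mu : {measure set T -> \bar R}) (phi : T -> R) (C : R) :
  mu setT < +oo -> measurable_fun setT phi -> (forall x, (`|phi x| <= C)%R) ->
  mu.-integrable setT (EFin \o phi).
Proof.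
move=> muoo mphi phiC; apply: (@le_integrable _ _ _ mu _ measurableT _ (EFin \o
  cst C)).
- exact/measurable_EFinP.
- by move=> x _ /=; rewrite lee_fin (le_trans (phiC x))// ler_norm.
- apply/integrableP; split; first exact/measurable_EFinP.
  have -> : \int[mu]_x `|(EFin \o cst C) x| = `|C|%:E * mu setT.
    exact: (@integral_cst _ _ _ mu setT measurableT `|C|%:E).
  by rewrite lte_mul_pinfty// abse_ge0.
Qed.

Lemma bounded_integral_ocons (phi : Omega R -> R) (C : R) :
  measurable_fun setT phi -> (forall x, (`|phi x| <= C)%R) ->
  measurable_fun setT (fun x => \int[m]_a phi (ocons a x))%R /\
  \int[P]_x (phi x)%:E = \int[P]_x ((\int[m]_a phi (ocons a x))%R)%:E.
Proof.
move=> mphi phiC.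
have mphi' : measurable_fun setT (fun p : unitI R * Omega R =>
  phi (ocons p.1 p.2)).
  exact: measurableT_comp mphi (@measurable_ocons R).
have ip : (m \x P).-integrable setT
    (EFin \o (fun p : unitI R * Omega R => phi (ocons p.1 p.2))).
  apply: (@bounded_integrable _ _ (m \x P) _ C) => //.
  rewrite [X in X < _](_ : _ = m setT * P setT).
    by rewrite !probability_setT mule1 ltry.
  by rewrite -setXTT; exact: product_measure1E.
have E x : ((\int[m]_a phi (ocons a x))%R)%:E = \int[m]_a (phi (ocons a x))%:E.
  rewrite fineK//; apply: integrable_fin_num => //.
  apply: (@bounded_integrable _ _ m _ C) => // [|]; last first.
    exact: measurableT_comp mphi (measurable_oconsl x).
  by rewrite [X in X < _]probability_setT ltry.
split.
  apply/measurable_EFinP; rewrite (_ : _ \o _ = fun x =>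
    \int[m]_a (phi (ocons a x))%:E).
    exact: measurable_fubini_G ip.
  by apply/funext => x /=; exact: E.
under [RHS]eq_integral do rewrite E.
pose Q' : {measure set (Omega R) -> \bar R} :=
  pushforward (m \x P) (fun p : unitI R * Omega R => ocons p.1 p.2).
transitivity (\int[Q' (@measurable_ocons R)]_x (phi x)%:E).
  by apply: eq_measure_integral => A mA _; exact/esym/pushforward_ocons.
rewrite integral_pushforward//; [|exact:
  measurable_ocons|exact/measurable_EFinP].
by rewrite preimage_setT -(integral21_prod_meas1 ip).
Qed.

(** The coordinates are independent. *)
Lemma integral_prod_coord N (u : nat -> unitI R -> R) :
  (forall i, measurable_fun setT (u i)) -> (forall i a, (0 <= u i a)%R) ->
  \int[P]_x ((\prod_(i < N) u i (x i))%R)%:E =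
    \prod_(i < N) \int[m]_a (u i a)%:E.
Proof.
elim: N u => [|N IH] u mu u0.
  under eq_integral do rewrite big_ord0.
  by rewrite big_ord0 integral_cst// mul1e [LHS]probability_setT.
have mprod (v : nat -> unitI R -> R) k : (forall i, measurable_fun setT (v i))
  ->
    measurable_fun setT (fun x : Omega R => \prod_(i < k) v i (x i))%R.
  move=> mv; apply: measurable_prod => i _.
  exact: measurableT_comp (mv i) (@measurable_coord R i).
rewrite ge0_integral_ocons; last 2 first.
- by apply/measurable_EFinP; exact: (mprod u).
- by move=> x; rewrite lee_fin prodr_ge0.
rewrite big_ord_recl -(IH (fun i => u i.+1))//.
rewrite -ge0_integralZl//; last 3 first.
- by apply/measurable_EFinP; exact: (mprod (fun i => u i.+1)).
- by move=> x _; rewrite lee_fin prodr_ge0.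
- by apply: integral_ge0 => a _; rewrite lee_fin.
apply: eq_integral => x _; rewrite -ge0_integralZr//.
- by apply: eq_integral => a _; rewrite big_ord_recl.
- exact/measurable_EFinP.
- by move=> a _; rewrite lee_fin.
- by rewrite lee_fin prodr_ge0.
Qed.

End product_integral.

(** * Series of functions of independent variables *)
Section series_facts.
Variable R : realType.

(** If the partial sums of [v i (x i)] are bounded above for each choice of the
    points [x i], they are bounded above uniformly in this choice: take for
    [x i] a point where [v i] is within [2^-(i+1)] of its supremum. *)
Lemma uniform_partial_sums (T : pointedType) (v : nat -> T -> R) :
  (forall i, exists C, forall a, v i a <= C) ->
  (forall x : nat -> T, exists C, forall N, \sum_(i < N) v i (x i) <= C) ->
  exists C, forall N (x : nat -> T), \sum_(i < N) v i (x i) <= C.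
Proof.
move=> vb xb.
have supv i : has_sup (range (v i)).
  split; first by exists (v i point), point.
  by have [C vC] := vb i; exists C => _ [a _ <-].
have /choice[y vy] : forall i, exists y, forall a, v i a <= v i y + 2^-1 ^+
  i.+1.
  move=> i; have e0 : 0 < (2^-1 : R) ^+ i.+1 by rewrite exprn_gt0// invr_gt0.
  have [_ [y _ <-] vy] := sup_adherent e0 (supv i); exists y => a.
  rewrite -lerBlDr; apply: le_trans (ltW vy); rewrite lerD2r.
  by apply: ub_le_sup; [exact: (supv i).2|exists a].
have [C yC] := xb y; exists (C + 1) => N x.
have : \sum_(i < N) v i (x i) <= \sum_(i < N) (v i (y i) + 2^-1 ^+ i.+1).
  by apply: ler_sum => i _.
move=> /le_trans; apply; rewrite big_split/=; apply: lerD; first exact: yC.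
apply: (@le_trans _ _ (1 - 2^-1 ^+ N)); last by rewrite gerBl exprn_ge0.
elim: N => [|N IH]; first by rewrite big_ord0 expr0 subrr.
by rewrite big_ord_recr/= (le_trans (lerD IH (lexx _)))// exprS; lra.
Qed.

Lemma cvg_series_tail (u : nat -> R) n : cvgn (series u) ->
  series (fun k => u (n + k)%N) @ \oo --> limn (series u) - series u n.
Proof.
move=> cu; have -> : series (fun k => u (n + k)%N) =
    fun N => series u (N + n)%N - series u n.
  apply/funext => N; rewrite /series/= addnC.
  rewrite (big_cat_nat (leq0n n) (leq_addr N n))/= [X in X - _]addrC addrK.
  rewrite -{2}[n]add0n big_addn addKn.
  by apply: eq_bigr => i _; rewrite addnC.
by apply: cvgB; [rewrite (cvg_shiftn n (series u))|exact: cvg_cst].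
Qed.

Lemma inf_prod_expR (u : nat -> R) : cvgn (series u) ->
  inf_prod (fun i => expR (u i)) = expR (limn (series u)).
Proof.
move=> cu; apply/cvg_lim => //.
rewrite [X in X @ _ --> _](_ : _ = expR \o series u); last first.
  by apply/funext => n /=; rewrite /series/= big_mkord expR_sum.
exact: (continuous_cvg _ (@continuous_expR R _) cu).
Qed.

Lemma series_norm_le (u : nat -> R) C : cvgn (series u) ->
  (forall N, `|series u N| <= C) -> `|limn (series u)| <= C.
Proof.
move=> cu uC; rewrite ler_norml; apply/andP; split.
  by apply: limr_ge => //; apply: nearW => N; have := uC N;
    rewrite ler_norml => /andP[].
by apply: limr_le => //; apply: nearW => N; have := uC N; rewrite ler_norml =>
  /andP[].
Qed.

Lemma cvg_partial_sums_bounded (u : nat -> R) : cvgn (series u) ->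
  exists C, forall N, `|\sum_(i < N) u i| <= C.
Proof.
move=> /cvg_seq_bounded[M [_ Mu]]; exists (M + 1) => N.
have := Mu (M + 1); rewrite ltrDl ltr01 => /(_ isT N Logic.I).
by rewrite /series/= big_mkord.
Qed.

End series_facts.

(** * Potentials of product type *)
Section potential.
Variables (R : realType) (fs : nat -> unitI R -> R) (f : Omega R -> R).
Hypothesis f_abs_cvg : forall x : Omega R, cvgn (series (fun j =>
  `|fs j (x j)|)).
Hypothesis f_product : forall x : Omega R, f x = limn (series (fun j =>
  fs j (x j))).
Hypothesis f_continuous : continuous f.
Hypothesis iterated_cvg : forall x : Omega R,
  cvgn (series (fun j => limn (series (fun k => fs (j.+1 + k)%N (x j))))).
Implicit Types (x : Omega R) (a : unitI R).

Lemma is_cvg_potential x : cvgn (series (fun j => fs j (x j))).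
Proof. exact/normed_cvg/f_abs_cvg. Qed.

(** The sequence with [a] at position [i] and the default value elsewhere. *)
Definition single i a : Omega R := fun j => if j == i then a else point.

Lemma potential_single i a :
  fs i a = f (single i a) - f (fun=> point) + fs i point.
Proof.
apply/eqP; rewrite -subr_eq eq_sym; apply/eqP.
have h1 := @is_cvg_potential (single i a).
have h2 := @is_cvg_potential (fun=> point).
rewrite !f_product -limB//; apply/cvg_lim => //; apply: cvg_near_cst.
exists i.+1 => // N /= iN; rewrite ?fctE /series/= !big_mkord -sumrB.
rewrite (bigD1 (Ordinal iN))//= /single eqxx big1 ?addr0// => j ji.
by rewrite ifN ?subrr//; apply: contra ji => /eqP ji; apply/eqP/val_inj.
Qed.

Lemma measurable_single i : measurable_fun setT (single i).
Proof.
apply: measurable_fun_Omega => n; rewrite /single.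
by case: (n == i); [exact: measurable_id|exact: measurable_cst].
Qed.

Lemma measurable_fs i : measurable_fun setT (fs i).
Proof.
rewrite (_ : fs i = fun a => f (single i a) - f (fun=> point) + fs i point).
  apply: measurable_funD => //; apply: measurable_funB => //.
  apply: measurableT_comp (measurable_single i).
  exact: continuous_Omega_measurable.
by apply/funext => a; exact: potential_single.
Qed.

Lemma bounded_fs i : exists C, forall a, `|fs i a| <= C.
Proof.
have [C fC] := continuous_Omega_bounded f_continuous.
exists (C + C + `|fs i point|) => a; rewrite {1}potential_single.
apply: (le_trans (ler_normD _ _)); rewrite lerD2r.
by apply: (le_trans (ler_normB _ _)); rewrite lerD.
Qed.

(** In other words, the series of the sup norms of the [fs i] converges. *)
Lemma potential_normally_bounded :
  exists C, forall N x, \sum_(i < N) `|fs i (x i)| <= C.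
Proof.
have [||C h] := @uniform_partial_sums R (unitI R) (fun i a => `|fs i a|).
- exact: bounded_fs.
- move=> x; have [C xC] := cvg_partial_sums_bounded (@f_abs_cvg x).
  by exists C => N; rewrite (le_trans _ (xC N))// ler_norm.
by exists C => N x; exact: h.
Qed.

Lemma cvg_Fdiag a : series (fun i => fs i a) @ \oo --> Fdiag fs a.
Proof. exact: (@is_cvg_potential (fun=> a)). Qed.

Lemma measurable_Fdiag : measurable_fun setT (Fdiag fs).
Proof.
apply: (@measurable_fun_cvg _ _ _ _ (fun n a => \sum_(i < n) fs i a)) =>
  [n|a _].
  by apply: measurable_sum => i; exact: measurable_fs.
have := @cvg_Fdiag a; rewrite /series/=.
by under eq_fun do rewrite big_mkord.
Qed.

Lemma bounded_Fdiag : exists C, forall a, `|Fdiag fs a| <= C.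
Proof.
have [C hC] := potential_normally_bounded; exists C => a.
apply: series_norm_le => [|N]; first exact: (@is_cvg_potential (fun=> a)).
rewrite /series/= big_mkord; apply: le_trans (ler_norm_sum _ _ _) _.
exact: (hC N (fun=> a)).
Qed.

(** The tail [r_j(a)], sum of the [f_i(a)] over the indices [i] larger
    than [j]. *)
Definition tail j a : R := limn (series (fun k => fs (j.+1 + k)%N a)).

Lemma cvg_tail j a : series (fun k => fs (j.+1 + k)%N a) @ \oo --> tail j a.
Proof.
apply/cvg_ex; exists (Fdiag fs a - series (fun i => fs i a) j.+1).
exact: (@cvg_series_tail R (fun i => fs i a) j.+1 (@is_cvg_potential (fun=>
  a))).
Qed.

Lemma tailE j a : tail j a = Fdiag fs a - \sum_(i < j.+1) fs i a.
Proof.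
rewrite -[X in _ - X](big_mkord xpredT (fun i => fs i a)).
apply/cvg_lim => //.
exact: (@cvg_series_tail R (fun i => fs i a) j.+1 (@is_cvg_potential (fun=>
  a))).
Qed.

Lemma tailS j a : tail j a = fs j.+1 a + tail j.+1 a.
Proof. by rewrite !tailE [in RHS]big_ord_recr/=; ring. Qed.

Lemma measurable_tail j : measurable_fun setT (tail j).
Proof.
rewrite (_ : tail j = fun a => Fdiag fs a - \sum_(i < j.+1) fs i a).
  apply: measurable_funB; first exact: measurable_Fdiag.
  by apply: measurable_sum => i; exact: measurable_fs.
by apply/funext => a; exact: tailE.
Qed.

Lemma bounded_tail j : exists C, forall a, `|tail j a| <= C.
Proof.
have [C FC] := bounded_Fdiag; have [D fD] := potential_normally_bounded.
exists (C + D) => a; rewrite tailE; apply: (le_trans (ler_normB _ _)).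
rewrite lerD//; apply: le_trans (ler_norm_sum _ _ _) _.
exact: (fD j.+1 (fun=> a)).
Qed.

(** The function [H], logarithm of [hf] (lemma [hfE]). *)
Definition logh x : R := limn (series (fun j => tail j (x j))).

Lemma cvg_logh x : series (fun j => tail j (x j)) @ \oo --> logh x.
Proof. exact: iterated_cvg. Qed.

Lemma hsE j a : hs fs j a = expR (tail j a).
Proof. by rewrite /hs/gs inf_prod_expR//; apply: cvgP; exact: cvg_tail. Qed.

Lemma hfE x : hf fs x = expR (logh x).
Proof.
rewrite /hf -inf_prod_expR; last exact: iterated_cvg.
by congr inf_prod; apply/funext => j; exact: hsE.
Qed.

Lemma measurable_tail_coord j : measurable_fun setT (fun x => tail j (x j)).
Proof. exact: measurableT_comp (measurable_tail j) (@measurable_coord R j). Qed.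

Lemma measurable_logh : measurable_fun setT logh.
Proof.
apply: (@measurable_fun_cvg _ _ _ _
  (fun n x => \sum_(i < n) tail i (x i))) => [n|x _].
  by apply: measurable_sum => i; exact: measurable_tail_coord.
have := @cvg_logh x; rewrite /series/=.
by under eq_fun do rewrite big_mkord.
Qed.

Lemma bounded_tail_sums :
  exists C, forall N x, `|\sum_(i < N) tail i (x i)| <= C.
Proof.
have sb x := cvg_partial_sums_bounded (@iterated_cvg x).
have [||C hC] := @uniform_partial_sums R (unitI R) tail.
- by move=> i; have [C h] := bounded_tail i; exists C => a;
    rewrite (le_trans (ler_norm _)).
- by move=> x; have [C h] := sb x; exists C => N;
    rewrite (le_trans (ler_norm _)).
have [||D hD] := @uniform_partial_sums R (unitI R) (fun i a => - tail i a).
- move=> i; have [D h] := bounded_tail i; exists D => a.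
  by rewrite (le_trans (ler_norm _))// normrN.
- move=> x; have [D h] := sb x; exists D => N.
  by rewrite sumrN (le_trans (ler_norm _))// normrN.
exists (Num.max C D) => N x; rewrite ler_norml lerNl -sumrN !le_max.
by rewrite hC hD orbT.
Qed.

Lemma bounded_logh : exists C, forall x, `|logh x| <= C.
Proof.
have [C hC] := bounded_tail_sums; exists C => x.
apply: series_norm_le => [|N]; first exact: iterated_cvg.
by rewrite /series/= big_mkord.
Qed.

(** The cohomological identity: up to a coboundary, the potential is a function
    of the first coordinate. *)
Lemma potential_cohomology a x :
  f (ocons a x) = Fdiag fs a - logh (ocons a x) + logh x.
Proof.
pose u j := fs j (ocons a x j); pose v j := tail j (ocons a x j).
have cu : cvgn (series u) by exact: is_cvg_potential.
have s1 (w : nat -> R) : series w 1%N = w 0%N by rewrite /series/= big_nat1.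
have cv : cvgn (series v) by exact: iterated_cvg.
have -> : logh x = (f (ocons a x) - fs 0%N a) + (logh (ocons a x) - tail 0%N a).
  apply/cvg_lim => //.
  rewrite [X in X @ _ --> _](_ : _ = series (fun k => u (1 + k)%N) \+
      series (fun k => v (1 + k)%N)); last first.
    apply/funext => n; rewrite /series/= -big_split/=.
    by apply: eq_bigr => i _; rewrite tailS.
  have -> : f (ocons a x) - fs 0%N a = limn (series u) - series u 1.
    by rewrite f_product s1.
  have -> : logh (ocons a x) - tail 0%N a = limn (series v) - series v 1.
    by rewrite s1.
  by apply: cvgD; exact: cvg_series_tail.
by rewrite tailE big_ord_recr big_ord0/=; ring.
Qed.

Lemma inf_prod_gs a : inf_prod (fun j => gs fs j a) = expR (Fdiag fs a).
Proof. by rewrite inf_prod_expR//; exact: (@is_cvg_potential (fun=> a)). Qed.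

Lemma lambdafE : lambdaf fs = \int[@lebesgueI R]_a expR (Fdiag fs a).
Proof. by apply: eq_Rintegral => a _; exact: inf_prod_gs. Qed.

End potential.

(** * The product measures of the potential *)
Section bounded_integral.
Context d (T : measurableType d) (R : realType) (mu : {measure set T -> \bar
  R}).
Hypothesis mu1 : mu setT = 1%E.

Local Open Scope ereal_scope.

Lemma fin_num_integral_bounded (w : T -> R) (C : R) :
  measurable_fun setT w -> (forall x, (`|w x| <= C)%R) ->
  \int[mu]_x (w x)%:E \is a fin_num.
Proof.
move=> mw wC; apply: integrable_fin_num => //.
by apply: (@bounded_integrable _ _ _ mu w C) => //; rewrite mu1 ltry.
Qed.

Lemma integral_expR (w : T -> R) (C : R) :
  measurable_fun setT w -> (forall x, (`|w x| <= C)%R) ->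
  \int[mu]_x (expR (w x))%:E \is a fin_num /\
  (0 < fine (\int[mu]_x (expR (w x))%:E))%R.
Proof.
move=> mw wC.
have fin : \int[mu]_x (expR (w x))%:E \is a fin_num.
  apply: (@fin_num_integral_bounded _ (expR C)).
    exact: measurableT_comp (@measurable_expR R) mw.
  by move=> x; rewrite ger0_norm ?expR_ge0// ler_expR (le_trans (ler_norm _)).
split=> //; rewrite -lte_fin fineK//.
apply: (@lt_le_trans _ _ (expR (- C))%:E); first by rewrite lte_fin expR_gt0.
have -> : (expR (- C))%:E = \int[mu]_x (expR (- C))%:E.
  by rewrite (@integral_cst _ _ _ mu setT measurableT) mu1 mule1.
apply: ge0_le_integral => //.
- by apply/measurable_EFinP; exact: measurableT_comp (@measurable_expR R) mw.
- by move=> x _; rewrite lee_fin ler_expR; have := wC x; rewrite ler_norml =>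
    /andP[].
Qed.

End bounded_integral.

Section potential_measures.
Variables (R : realType) (fs : nat -> unitI R -> R) (f : Omega R -> R).
Hypothesis f_abs_cvg : forall x : Omega R, cvgn (series (fun j =>
  `|fs j (x j)|)).
Hypothesis f_product : forall x : Omega R, f x = limn (series (fun j =>
  fs j (x j))).
Hypothesis f_continuous : continuous f.
Hypothesis iterated_cvg : forall x : Omega R,
  cvgn (series (fun j => limn (series (fun k => fs (j.+1 + k)%N (x j))))).
Implicit Types (x : Omega R) (a : unitI R).

Local Open Scope ereal_scope.

Lemma lebesgueI1 : @lebesgueI R setT = 1.
Proof.
rewrite /lebesgueI (_ : _ @` _ = `[0%R, 1%R]%classic).
  by rewrite lebesgue_measure_itv/= lte_fin ltr01 oppr0 adde0.
apply/seteqP; split=> [r [a _ <-]|r /=].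
  by rewrite /= in_itv/= uval_ge0 uval_le1.
by rewrite in_itv/= => r01; exists (exist (fun s : R => 0 <= s <= 1)%R r r01).
Qed.

Let mF : measurable_fun setT (Fdiag fs).
Proof. exact: (measurable_Fdiag f_abs_cvg f_product f_continuous). Qed.

Let bF := bounded_Fdiag f_abs_cvg f_product f_continuous.

Lemma lambdaf_gt0 : (0 < lambdaf fs)%R.
Proof.
have [C hC] := bF; rewrite (lambdafE f_abs_cvg) /Rintegral.
by have [] := integral_expR lebesgueI1 mF hC.
Qed.

Lemma integral_lambdaf : \int[@lebesgueI R]_a (expR (Fdiag fs a))%:E =
  (lambdaf fs)%:E.
Proof.
have [C hC] := bF; rewrite (lambdafE f_abs_cvg) /Rintegral fineK//.
by have [] := integral_expR lebesgueI1 mF hC.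
Qed.

Let w a := (expR (Fdiag fs a) / lambdaf fs)%R.

Let mw : measurable_fun setT w.
Proof.
apply: measurable_funM => //.
exact: measurableT_comp (@measurable_expR R) mF.
Qed.

Let w0 a : (0 <= w a)%R.
Proof. by rewrite divr_ge0 ?expR_ge0// ltW// lambdaf_gt0. Qed.

Let nu : {measure set (unitI R) -> \bar R} :=
  @density _ _ _ (@lebesgueI R) w mw w0.

Let nu1 : nu setT = 1.
Proof.
rewrite /nu/= /density /w; under eq_integral do rewrite EFinM.
rewrite ge0_integralZr//.
- by rewrite integral_lambdaf -EFinM divff// gt_eqF// lambdaf_gt0.
- by apply/measurable_EFinP; exact: measurableT_comp (@measurable_expR R) mF.
- by rewrite lee_fin invr_ge0 ltW// lambdaf_gt0.
Qed.

(** The probability of density [e^F / lambda] on the unit interval. *)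
Definition diag_probability : probability (unitI R) R := as_probability nu1.

Local Notation m := diag_probability.

Lemma integral_diag_probability (phi : unitI R -> R) : measurable_fun setT phi
  ->
  \int[m]_a (phi a)%:E =
  \int[@lebesgueI R]_a (phi a * (expR (Fdiag fs a) / lambdaf fs))%:E.
Proof. exact: integral_density. Qed.

Lemma mutilde_factorE A : mutilde_factor fs A = m A.
Proof.
by apply: eq_integral => a _; rewrite (inf_prod_gs f_abs_cvg).
Qed.

Lemma mu_factorE j A : measurable A ->
  mu_factor fs j A = \int[m]_a (\1_A a * expR (- tail fs j a))%:E.
Proof.
move=> mA; rewrite integral_diag_probability; last first.
  apply: measurable_funM => //; apply: measurableT_comp => //.
  apply: measurableT_comp => //.
  exact: (measurable_tail f_abs_cvg f_product f_continuous).
rewrite /mu_factor integral_mkcond; apply: eq_integral => a _.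
rewrite patchE indicE; case: ifP => _; last by rewrite !mul0r.
rewrite mul1r mulrA -expRD -expR_sum (tailE f_abs_cvg) opprB addrNK.
by rewrite -/(lambdaf fs).
Qed.

Lemma mu_factor_fin j A : measurable A -> mu_factor fs j A \is a fin_num.
Proof.
move=> mA; rewrite mu_factorE//.
have [C hC] := bounded_tail f_abs_cvg f_product f_continuous j.
apply: (@fin_num_integral_bounded _ _ _ m _ _ (expR C)).
- exact: probability_setT.
- apply: measurable_funM => //; apply: measurableT_comp => //.
  apply: measurableT_comp => //.
  exact: (measurable_tail f_abs_cvg f_product f_continuous).
- move=> a; rewrite normrM [X in (_ * X)%R]ger0_norm ?expR_ge0//.
  rewrite (@le_trans _ _ (1 * expR (- tail fs j a))%R)//.
    rewrite ler_wpM2r ?expR_ge0// indicE.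
    by case: (_ \in _); rewrite ?normr1 ?normr0.
  by rewrite mul1r ler_expR lerNl; have := hC a; rewrite ler_norml => /andP[].
Qed.

Lemma mu_factor_mass_gt0 j : (0 < fine (mu_factor fs j setT))%R.
Proof.
have [C hC] := bounded_tail f_abs_cvg f_product f_continuous j.
rewrite mu_factorE//; under eq_integral do rewrite indicT mul1r.
have [] // := @integral_expR _ _ _ m (probability_setT m) (fun a =>
  - tail fs j a)%R C.
- apply: measurableT_comp => //.
  exact: (measurable_tail f_abs_cvg f_product f_continuous).
- by move=> a; rewrite normrN.
Qed.

Section product_measure.
Variable P : probability (Omega R) R.
Hypothesis PE : forall n (A : nat -> set (unitI R)),
  (forall i, measurable (A i)) -> P (cylinder n A) = \prod_(i < n) m (A i).

Let mlogh : measurable_fun setT (logh fs).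
Proof. exact: (measurable_logh f_abs_cvg f_product f_continuous). Qed.

Let blogh := bounded_logh f_abs_cvg f_product f_continuous iterated_cvg.

Let mexp : measurable_fun setT (fun x => expR (- logh fs x)).
Proof. by apply: measurableT_comp => //; exact: measurableT_comp. Qed.

Let mtail j : measurable_fun setT (tail fs j).
Proof. exact: (measurable_tail f_abs_cvg f_product f_continuous). Qed.

(** Dominated convergence for the partial products of [1 / hf]. *)
Lemma cvg_cylinder n (A : nat -> set (unitI R)) : (forall i, measurable (A i))
  ->
  (\prod_(j < N) fine (mu_factor fs j (if (j < n)%N then A j else setT)))%:E
    @[N --> \oo] --> \int[P]_x (\1_(cylinder n A) x * expR (- logh fs x))%:E.
Proof.
move=> mA; pose A' j := if (j < n)%N then A j else setT.
have mA' j : measurable (A' j) by rewrite /A'; case: ifP.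
pose u j a : R := (\1_(A' j) a * expR (- tail fs j a))%R.
have mu_ j : measurable_fun setT (u j).
  apply: measurable_funM => //; apply: measurableT_comp => //.
  exact: measurableT_comp.
have u0 j a : (0 <= u j a)%R by rewrite mulr_ge0 ?expR_ge0.
have -> : (fun N => (\prod_(j < N) fine (mu_factor fs j (A' j)))%:E) =
    fun N => \int[P]_x ((\prod_(j < N) u j (x j))%R)%:E.
  apply/funext => N; rewrite (integral_prod_coord PE)//.
  rewrite -prodEFin; apply: eq_bigr => j _.
  by rewrite fineK ?mu_factor_fin// mu_factorE.
have [C hC] := bounded_tail_sums f_abs_cvg f_product f_continuous iterated_cvg.
have mprod N : measurable_fun setT (fun x => \prod_(j < N) u j (x j))%R.
  apply: measurable_prod => j _.
  exact: measurableT_comp (mu_ j) (@measurable_coord R j).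
have uE N x : (\prod_(j < N) u j (x j) = \1_(cylinder N A') x *
    expR (- \sum_(j < N) tail fs j (x j)))%R.
  rewrite big_split/= -sumrN expR_sum; congr (_ * _)%R.
  rewrite indicE; have [/set_mem Ax|nAx] := boolP (x \in _).
    by rewrite big1// => j _; rewrite indicE mem_set//; exact: Ax.
  move: nAx; rewrite notin_setE => /existsNP[j /not_implyP[jN nA]].
  by rewrite (bigD1 (Ordinal jN))//= indicE memNset// mul0r.
have [] // := @dominated_convergence _ _ _ P _ measurableT
  (fun N x => (\prod_(j < N) u j (x j))%:E)
  (fun x => (\1_(cylinder n A) x * expR (- logh fs x))%:E) (cst (expR C)%:E).
- by move=> N; apply/measurable_EFinP.
- apply/measurable_EFinP; apply: measurable_funM => //.
  by apply: measurable_indic; exact: measurable_cylinder.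
- apply: aeW => x _; apply: cvg_EFin; first exact: nearW.
  rewrite [X in X @ _ --> _](_ : _ = (fun N => (\1_(cylinder N A') x : R)) \*
      (fun N => expR (- \sum_(j < N) tail fs j (x j))))%R; last first.
    by apply/funext => N /=; exact: uE.
  apply: cvgM.
    apply: cvg_near_cst; exists n => // N /= nN.
    by rewrite cylinder_widen.
  apply: (continuous_cvg _ (@continuous_expR R _)); apply: cvgN.
  have := @cvg_logh _ _ iterated_cvg x; rewrite /series/=.
  by under eq_fun do rewrite big_mkord.
- exact: finite_measure_integrable_cst.
- apply: aeW => x N _; rewrite lee_fin ger0_norm; last exact: prodr_ge0.
  rewrite uE -[leRHS]mul1r ler_pM ?expR_ge0//.
  by rewrite ler_expR lerNl; have := hC N x; rewrite ler_norml => /andP[].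
Qed.

Let nuP : {measure set (Omega R) -> \bar R} :=
  @density _ _ _ P _ mexp (fun x => expR_ge0 _).

(** The measure of density [1 / hf] with respect to the product measure. *)
Definition eigenmeasure : {measure set (Omega R) -> \bar R} := nuP.

Lemma integral_eigenmeasure (phi : Omega R -> R) : measurable_fun setT phi ->
  \int[eigenmeasure]_x (phi x)%:E = \int[P]_x (phi x * expR (- logh fs x))%:E.
Proof. exact: integral_density. Qed.

(** The limit of the products of the masses of the [mu_j], by
    [cvg_eigenmass] below. *)
Definition eigenmass : R := fine (eigenmeasure setT).

Let eigenmass_fin_gt0 : eigenmeasure setT \is a fin_num /\ (0 < eigenmass)%R.
Proof.
have [C hC] := blogh.
apply: (@integral_expR _ _ _ P (probability_setT P) (fun x => - logh fs x)%R C).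
  exact: measurableT_comp.
by move=> x; rewrite normrN.
Qed.

Lemma eigenmassE : eigenmeasure setT = eigenmass%:E.
Proof. by rewrite fineK//; have [] := eigenmass_fin_gt0. Qed.

Lemma eigenmass_gt0 : (0 < eigenmass)%R.
Proof. by have [] := eigenmass_fin_gt0. Qed.

Lemma eigenmeasure_indic A : measurable A ->
  eigenmeasure A = \int[P]_x (\1_A x * expR (- logh fs x))%:E.
Proof.
move=> mA; rewrite [LHS]integral_mkcond; apply: eq_integral => x _.
by rewrite patchE indicE; case: ifP => _; rewrite ?mul1r ?mul0r.
Qed.

Lemma cvg_eigenmass :
  (\prod_(j < N) fine (mu_factor fs j setT))%R @[N --> \oo] --> eigenmass.
Proof.
have /= := @cvg_cylinder 0 (fun=> setT) (fun=> measurableT).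
rewrite -eigenmeasure_indic; last exact: measurable_cylinder.
rewrite (_ : cylinder 0 _ = setT); last by apply/seteqP; split.
by rewrite eigenmassE => /fine_cvg.
Qed.

(** The cylinder values that characterise the product of the measures
    [mu_j]. *)
Lemma eigenmeasure_cylinder n (A : nat -> set (unitI R)) :
  (forall i, measurable (A i)) ->
  eigenmeasure (cylinder n A) = (eigenmass * \prod_(j < n)
    (fine (mu_factor fs j (A j)) / fine (mu_factor fs j setT)))%:E.
Proof.
move=> mA; rewrite eigenmeasure_indic; last exact: measurable_cylinder.
set r := (\prod_(j < n) _)%R.
rewrite -(cvg_lim _ (@cvg_cylinder n A mA))//; apply/cvg_lim => //.
apply: cvg_EFin; first exact: nearW.
have : (\prod_(j < N) fine (mu_factor fs j setT) * r)%R @[N --> \oo] -->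
    (eigenmass * r)%R.
  by apply: cvgM; [exact: cvg_eigenmass|exact: cvg_cst].
apply: cvg_trans; apply: near_eq_cvg; exists n => // N /= nN.
(* For [n <= N], the factors of index at least [n] are full masses. *)
rewrite /r (big_ord_widen N (fun j => fine (mu_factor fs j (A j)) /
  fine (mu_factor fs j setT)))%R// [X in (_ * X)%R]big_mkcond/= -big_split/=.
apply: eq_bigr => j _; case: ifP => _; last by rewrite mulr1.
by rewrite mulrC divfK// gt_eqF// mu_factor_mass_gt0.
Qed.

Lemma product_tilde_is_product :
  is_product_measure (fun=> mutilde_factor fs) P.
Proof.
have m1 : fine (mutilde_factor fs setT) = 1%R.
  by rewrite mutilde_factorE [X in fine X]probability_setT.
exists 1%R, P; split.
- rewrite [X in X @ _ --> _](_ : _ = cst 1%R); first exact: cvg_cst.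
  by apply/funext => N; rewrite big1.
- move=> n A mA; rewrite [LHS](PE n mA) -prodEFin; apply: eq_bigr => i _.
  rewrite m1 divr1 fineK ?mutilde_factorE//; exact: fin_num_measure.
- by move=> A mA; rewrite mul1e.
Qed.

Lemma eigenmeasure_is_product : is_product_measure (mu_factor fs) eigenmeasure.
Proof.
have k0 : (0 <= eigenmass^-1)%R by rewrite invr_ge0 ltW// eigenmass_gt0.
pose Q0 : {measure set (Omega R) -> \bar R} := mscale (NngNum k0) eigenmeasure.
have Q01 : Q0 setT = 1.
  by rewrite /Q0/= /mscale/= eigenmassE -EFinM mulVf// gt_eqF// eigenmass_gt0.
exists eigenmass, (as_probability Q01); split.
- exact: cvg_eigenmass.
- move=> n A mA; rewrite [LHS](_ : _ = eigenmass^-1%:E * eigenmeasure (cylinder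
    n A))//.
  by rewrite eigenmeasure_cylinder// -EFinM mulKf// gt_eqF// eigenmass_gt0.
- move=> A mA; rewrite [X in _ * X](_ : _ = eigenmass^-1%:E * eigenmeasure A)//.
  by rewrite muleA -EFinM divff ?mul1e// gt_eqF// eigenmass_gt0.
Qed.

Lemma eigenmeasure_unique (mu_f : {measure set (Omega R) -> \bar R}) :
  is_product_measure (mu_factor fs) mu_f ->
  forall A, measurable A -> mu_f A = eigenmeasure A.
Proof.
move=> [M [Q [cM QE mu_fE]]].
have ME : M = eigenmass by apply: (cvg_unique _ cM cvg_eigenmass).
apply: cylinder_measure_unique.
  by rewrite mu_fE// [X in _ * X]probability_setT mule1 ltry.
move=> n A mA; rewrite mu_fE; last exact: measurable_cylinder.
by rewrite [X in _ * X](QE n A mA) eigenmeasure_cylinder// ME.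
Qed.

Let mcont (phi : Omega R -> R) : continuous phi -> measurable_fun setT phi.
Proof. exact: continuous_Omega_measurable. Qed.

Lemma expR_normalized_potential a x :
  expR (normalized_potential fs f (ocons a x)) =
  (expR (Fdiag fs a) / lambdaf fs)%R.
Proof.
rewrite /normalized_potential (hfE f_abs_cvg iterated_cvg).
rewrite [X in hf fs X](_ : _ = x)// (hfE f_abs_cvg iterated_cvg) !expRK.
rewrite (potential_cohomology f_abs_cvg f_product iterated_cvg).
rewrite -[X in (_ / X)%R]lnK ?posrE ?lambdaf_gt0// -expRN -expRD.
by congr expR; ring.
Qed.

(** The operator of the normalized potential averages over the first coordinate
    with respect to the diagonal probability. *)
Lemma ruelle_normalized (phi : Omega R -> R) x : measurable_fun setT phi ->
  ruelle (normalized_potential fs f) phi x = (\int[m]_a phi (ocons a x))%R.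
Proof.
move=> mphi; rewrite [RHS]/Rintegral integral_diag_probability; last first.
  exact: measurableT_comp mphi (measurable_oconsl x).
by apply: eq_Rintegral => a _; rewrite expR_normalized_potential mulrC.
Qed.

(** The operator of the potential, expressed by that of the normalized one
    through the cohomological identity. *)
Lemma ruelle_potential (phi : Omega R -> R) C x : measurable_fun setT phi ->
  (forall y, `|phi y| <= C)%R ->
  ruelle f phi x = (expR (logh fs x) * \int[m]_a
    (lambdaf fs * (phi (ocons a x) * expR (- logh fs (ocons a x)))))%R.
Proof.
move=> mphi phiC; have [D hD] := blogh.
have mo := measurable_oconsl x.
have mg : measurable_fun setT (fun a =>
    lambdaf fs * (phi (ocons a x) * expR (- logh fs (ocons a x))))%R.
  apply: measurable_funM => //; apply: measurable_funM.
    exact: measurableT_comp mphi mo.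
  exact: measurableT_comp mexp mo.
rewrite -RintegralZl//; last first.
  apply: (@bounded_integrable _ _ _ m _ (lambdaf fs * (C * expR D))%R) => //.
    by rewrite [X in X < _]probability_setT ltry.
  move=> a; rewrite normrM ger0_norm ?lambdaf_ge0// ler_wpM2l ?lambdaf_ge0//.
  rewrite normrM ler_pM// ger0_norm ?expR_ge0// ler_expR lerNl.
  by have := hD (ocons a x); rewrite ler_norml => /andP[].
rewrite [in RHS]/Rintegral integral_diag_probability;
  last exact: measurable_funM.
apply: eq_Rintegral => a _.
rewrite (potential_cohomology f_abs_cvg f_product iterated_cvg) !expRD.
by field; rewrite gt_eqF// lambdaf_gt0.
Qed.

Lemma ruelle_dual_normalized : ruelle_dual (normalized_potential fs f) P P.
Proof.
move=> phi cphi; have [C phiC] := continuous_Omega_bounded cphi.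
have [_ ->] := bounded_integral_ocons PE (mcont cphi) phiC.
by apply: eq_integral => x _; rewrite ruelle_normalized//; exact: mcont.
Qed.

Lemma reweighted_eigenmeasure : reweighted (fun x =>
  (hf fs x)^-1)%R P eigenmeasure.
Proof.
move=> phi cphi; rewrite integral_eigenmeasure; last exact: mcont.
by apply: eq_integral => x _; rewrite (hfE f_abs_cvg iterated_cvg) expRN.
Qed.

Lemma ruelle_dual_eigenmeasure :
  ruelle_dual f eigenmeasure (mscale (NngNum (lambdaf_ge0 fs)) eigenmeasure).
Proof.
move=> phi cphi; have [C phiC] := continuous_Omega_bounded cphi.
have mphi := mcont cphi; have [D hD] := blogh.
(* The function [lambda phi / h_f], to which the invariance of [P] applies. *)
pose psi x := (lambdaf fs * (phi x * expR (- logh fs x)))%R.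
have mpsi : measurable_fun setT psi.
  by apply: measurable_funM => //; exact: measurable_funM.
have psiC x : (`|psi x| <= lambdaf fs * (C * expR D))%R.
  rewrite normrM ger0_norm ?lambdaf_ge0// ler_wpM2l ?lambdaf_ge0//.
  rewrite normrM ler_pM// ger0_norm ?expR_ge0// ler_expR lerNl.
  by have := hD x; rewrite ler_norml => /andP[].
have [mT TE] := bounded_integral_ocons PE mpsi psiC.
(* Multiplying a measure by [lambda] amounts to giving it a constant density. *)
have mk : measurable_fun setT (cst (lambdaf fs) : Omega R -> R) by [].
transitivity (\int[eigenmeasure]_x (phi x * lambdaf fs)%:E).
  pose dl : {measure set (Omega R) -> \bar R} :=
    @density _ _ _ eigenmeasure _ mk (fun=> lambdaf_ge0 fs).
  transitivity (\int[dl]_x (phi x)%:E); last exact: integral_density.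
  apply: eq_measure_integral => A mA _.
  exact/esym/(@integral_cst _ _ _ eigenmeasure A mA (lambdaf fs)%:E).
rewrite [LHS]integral_eigenmeasure; last exact: (measurable_funM mphi mk).
rewrite [RHS]integral_eigenmeasure; last first.
  rewrite (_ : ruelle f phi = fun x => expR (logh fs x) * \int[m]_a psi (ocons
    a x))%R.
    apply: measurable_funM => //; exact: measurableT_comp.
  by apply/funext => x; exact: ruelle_potential phiC.
transitivity (\int[P]_x (psi x)%:E).
  by apply: eq_integral => x _; rewrite /psi mulrAC mulrC.
rewrite TE; apply: eq_integral => x _; congr EFin.
by rewrite (ruelle_potential x mphi phiC) expRN mulrAC divff ?mul1r// gt_eqF//
  expR_gt0.
Qed.

End product_measure.

Lemma product_tilde_unique (mut_f : {measure set (Omega R) -> \bar R}) :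
  is_product_measure (fun=> mutilde_factor fs) mut_f ->
  exists P : probability (Omega R) R,
    (forall n (A : nat -> set (unitI R)), (forall i, measurable (A i)) ->
      P (cylinder n A) = \prod_(i < n) m (A i)) /\
    forall A, measurable A -> mut_f A = P A.
Proof.
move=> [M [P [cM PE mutE]]]; exists P.
have m1 : fine (mutilde_factor fs setT) = 1%R.
  by rewrite mutilde_factorE [X in fine X]probability_setT.
split=> [n A mA|A mA].
  rewrite [LHS](PE n A mA) -prodEFin; apply: eq_bigr => i _.
  by rewrite m1 divr1 mutilde_factorE fineK//; exact: fin_num_measure.
suff M1 : M = 1%R by rewrite mutE// M1 mul1e.
rewrite -(cvg_lim _ cM)//; apply/cvg_lim => //.
rewrite [X in X @ _ --> _](_ : _ = cst 1%R); first exact: cvg_cst.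
by apply/funext => N; rewrite big1.
Qed.

End potential_measures.

(** * The eigenmeasures *)
Theorem proposition3 (R : realType) (fs : nat -> unitI R -> R)
  (f : Omega R -> R)
  (f_abs_cvg : forall x : Omega R, cvgn (series (fun j => `|fs j (x j)|)))
  (f_product : forall x : Omega R, f x = limn (series (fun j => fs j (x j))))
  (f_continuous : continuous f)
  (iterated_cvg : forall x : Omega R,
     cvgn (series (fun j => limn (series (fun k => fs (j.+1 + k)%N (x j)))))) :
  [/\ forall A : set (unitI R), measurable A ->
        mutilde_factor fs A =
        (\int[@lebesgueI R]_(a in A)
           (expR (Fdiag fs a) / \int[@lebesgueI R]_b expR (Fdiag fs b))%R%:E)%E,
      exists mu_f : {measure set (Omega R) -> \bar R},
        is_product_measure (mu_factor fs) mu_f,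
      exists mut_f : {measure set (Omega R) -> \bar R},
        is_product_measure (fun=> mutilde_factor fs) mut_f &
      forall mu_f mut_f : {measure set (Omega R) -> \bar R},
        is_product_measure (mu_factor fs) mu_f ->
        is_product_measure (fun=> mutilde_factor fs) mut_f ->
        [/\ ruelle_dual f mu_f (mscale (NngNum (lambdaf_ge0 fs)) mu_f),
            ruelle_dual (normalized_potential fs f) mut_f mut_f &
            reweighted (fun x => (hf fs x)^-1) mut_f mu_f]].
Proof.
have [P0 P0E] := product_probability_exists
  (diag_probability f_abs_cvg f_product f_continuous).
split.
- move=> A mA; apply: eq_integral => a _; congr ((_ / _)%:E).
    exact: inf_prod_gs.
  by apply: eq_Rintegral => b _; exact: inf_prod_gs.
- exists (eigenmeasure f_abs_cvg f_product f_continuous iterated_cvg P0).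
  exact: eigenmeasure_is_product.
- by exists P0; exact: product_tilde_is_product.
move=> mu_f mut_f mu_fP mut_fP.
have [P [PE mutE]] := product_tilde_unique f_abs_cvg f_product f_continuous
  mut_fP.
pose eig := eigenmeasure f_abs_cvg f_product f_continuous iterated_cvg P.
have muE A : measurable A -> mu_f A = eig A.
  by move=> mA; apply: eigenmeasure_unique.
have mu_int phi : (\int[mu_f]_x phi x = \int[eig]_x phi x)%E.
  by apply: eq_measure_integral => A mA _; exact: muE.
have mut_int phi : (\int[mut_f]_x phi x = \int[P]_x phi x)%E.
  by apply: eq_measure_integral => A mA _; exact: mutE.
split=> phi cphi.
- rewrite mu_int -(ruelle_dual_eigenmeasure iterated_cvg PE cphi).
  apply: eq_measure_integral => A mA _.
  by rewrite /= /mscale/= muE.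
- by rewrite !mut_int; exact: (ruelle_dual_normalized iterated_cvg PE).
- by rewrite mu_int mut_int; exact: reweighted_eigenmeasure.
Qed.
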